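(* Let $\gamma>-1$ and $\beta\in\mathbb{D}$. For the Weyl-type unitary operator $C_{\hat k^\gamma_\beta,\psi_{\beta,1}}$ on $A^2_\gamma(\mathbb{D})$, $\mathbf{ber}\left(C_{\hat k^\gamma_\beta,\psi_{\beta,1}}\right)=(1-|\beta|^2)^{\frac{\gamma+2}{2}}$.
   Context: $\mathbb{D}$ is the open unit disk and $\mathbb{T}$ the unit circle of $\mathbb{C}$; $dA$ is area measure on $\mathbb{D}$ normalized so that $\mathbb{D}$ has area $1$; $dA_\gamma(w)=(\gamma+1)(1-|w|^2)^\gamma dA(w)$. The weighted Bergman space $A^2_\gamma(\mathbb{D})$ is the Hilbert space of holomorphic functions $f$ on $\mathbb{D}$ with $\int_{\mathbb{D}}|f|^2dA_\gamma<\infty$, with inner product $\langle f,g\rangle=\int_{\mathbb{D}}f\bar g\,dA_\gamma$. Its normalized reproducing kernel at $\xi\in\mathbb{D}$ is $\hat k^\gamma_\xi(w)=\frac{(1-|\xi|^2)^{(\gamma+2)/2}}{(1-\bar\xi w)^{\gamma+2}}$ (principal branch of the power). For $\beta\in\mathbb{D}$, $\eta\in\mathbb{T}$, $\psi_{\beta,\eta}(w)=\eta\frac{w-\beta}{1-\bar\beta w}$, and the Weyl-type operator is $C_{\hat k^\gamma_\beta,\psi_{\beta,\eta}}f=\hat k^\gamma_\beta\,(f\circ\psi_{\beta,\eta})$ for $f\in A^2_\gamma(\mathbb{D})$. For a bounded linear operator $T$ on $A^2_\gamma(\mathbb{D})$, the Berezin transform is $\widetilde T(\xi)=\langle T\hat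 k^\gamma_\xi,\hat k^\gamma_\xi\rangle$, $\xi\in\mathbb{D}$, and the Berezin number is $\mathbf{ber}(T)=\sup_{\xi\in\mathbb{D}}|\widetilde T(\xi)|$. *)

(* Defs.v *)
From HB Require Import structures.
From mathcomp Require Import all_boot all_order all_algebra.
From mathcomp Require Import complex.
From mathcomp Require Import all_classical all_reals all_analysis.

Set Implicit Arguments.
Unset Strict Implicit.
Unset Printing Implicit Defensive.

Import Order.TTheory GRing.Theory Num.Theory.
Import numFieldNormedType.Exports.

Local Open Scope classical_set_scope.
Local Open Scope ring_scope.
Local Open Scope complex_scope.

Notation normc := ComplexField.Normc.normc.

Section Bergman.
Context {R : realType}.
Implicit Types (gamma s : R) (f : R[i] -> R[i]).

Definition disc : set R[i] := [set z | normc z < 1].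

(* z |-> z ^ s, principal branch: the argument is taken in ]-pi, pi].  The
   value of the argument at 0 is irrelevant, since the modulus of 0 ^ s is
   0 `^ s, which is 0 for s != 0. *)
Definition carg (z : R[i]) : R :=
  let t := acos (complex.Re z / normc z) in
  if 0 <= complex.Im z then t else - t.

Definition cpow (z : R[i]) s : R[i] :=
  (normc z `^ s)%:C * (cos (s * carg z) +i* sin (s * carg z)).

(* [R[i]] is identified with [R * R] in order to integrate. *)
Definition lebesgue2 := (@lebesgue_measure R \x @lebesgue_measure R)%E.

Definition cplx (p : R * R) : R[i] := p.1 +i* p.2.

Definition dens gamma (z : R[i]) : R :=
  (gamma + 1) * (1 - normc z ^+ 2) `^ gamma / pi.

(* The integral of |f|^2 over the disc with respect to dA_gamma. *)
Definition sqnorm gamma f : \bar R :=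
  (\int[lebesgue2]_(p in cplx @^-1` disc)
     (normc (f (cplx p)) ^+ 2 * dens gamma (cplx p))%:E)%E.

(* The integral of a complex function, through its real and imaginary parts. *)
Definition cintegral gamma f : R[i] :=
  Rintegral lebesgue2 (cplx @^-1` disc)
    (fun p => complex.Re (f (cplx p)) * dens gamma (cplx p)) +i*
  Rintegral lebesgue2 (cplx @^-1` disc)
    (fun p => complex.Im (f (cplx p)) * dens gamma (cplx p)).

(* The quotient in [derivable] is taken over [R[i]]: this is complex
   differentiability. *)
Definition holomorphic_disc f : Prop :=
  forall z, disc z -> derivable (f : R[i]^o -> R[i]^o) z 1.

(* A function on the disc is represented by its extension by 0. *)
Definition ext0 f : R[i] -> R[i] := fun z => if normc z < 1 then f z else 0.

Definition bergman_set gamma : set (R[i] -> R[i]) :=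
  [set f | [/\ holomorphic_disc f, (sqnorm gamma f < +oo)%E & ext0 f = f]].

Definition bergman gamma := {f : R[i] -> R[i] | f \in bergman_set gamma}.

Fact bergman_set0 gamma : (fun=> 0) \in bergman_set gamma.
Proof.
rewrite inE; split.
- by move=> z _; exact: derivable_cst.
- rewrite /sqnorm integral0_eq// => p _.
  by rewrite ComplexField.Normc.normc0 expr0n mul0r.
- by apply/funext => z; rewrite /ext0; case: ifP.
Qed.

Definition bergman0 gamma : bergman gamma :=
  exist (fun f => f \in bergman_set gamma) _ (bergman_set0 gamma).

(* The element of the Bergman space given by [f] on the disc; it is 0 when [f]
   is not holomorphic and square-integrable there. *)
Definition to_bergman gamma f : bergman gamma :=
  insubd (bergman0 gamma) (ext0 f).

Definition inner gamma (f g : bergman gamma) : R[i] :=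
  cintegral gamma (fun z => val f z * (val g z)^*).

Definition nkernel_fun gamma (xi w : R[i]) : R[i] :=
  ((1 - normc xi ^+ 2) `^ ((gamma + 2) / 2))%:C
  / cpow (1 - xi^* * w) (gamma + 2).

Definition nkernel gamma (xi : R[i]) : bergman gamma :=
  to_bergman gamma (nkernel_fun gamma xi).

Definition mobius (beta eta w : R[i]) : R[i] :=
  eta * ((w - beta) / (1 - beta^* * w)).

(* The weighted composition below is unitary when |beta| < 1 and |eta| = 1, so
   the default value of [to_bergman] does not occur. *)
Definition weyl gamma (beta eta : R[i]) (f : bergman gamma) : bergman gamma :=
  to_bergman gamma (fun w => nkernel_fun gamma beta w * val f (mobius beta eta w)).

Definition berezin gamma (T : bergman gamma -> bergman gamma) (xi : R[i]) :=
  inner (T (nkernel gamma xi)) (nkernel gamma xi).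

Definition ber gamma (T : bergman gamma -> bergman gamma) : \bar R :=
  ereal_sup [set (normc (berezin T xi))%:E | xi in disc].

End Bergman.

(* Main.v *)
(* With w |-> (1 - conj(a) w)^-s, s = gamma + 2, as unnormalized kernel K_a, the
   Weyl operator maps the normalized kernel at xi to a multiple of K_a, where
   a = (xi + beta) / (1 + conj(beta) xi); the reproducing property then gives
     |Berezin(xi)| = (1 - |beta|^2)^(s/2) (1 - |xi|^2)^s |z|^-s
   with z = 1 - |xi|^2 + 2 i Im(conj(xi) beta).  As |z| >= 1 - |xi|^2, the supremum
   is attained at xi = 0.

   The reproducing property <K_a, K_xi> = K_a(xi) is obtained in two steps.
   The function (xi - w) conj(K_xi(w)) (1 - |w|^2)^gamma is, up to a constant, the
   conjugate-holomorphic derivative of ((1 - |w|^2) / (1 - xi conj(w)))^(gamma + 1),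
   which vanishes on the circle; by the divergence theorem <(w - xi) q, K_xi> = 0
   for q(w) = (1 - b w)^r.  The t-derivative of
     (1 - t conj(a) xi)^s (1 - t conj(a) w)^-s
   has the form (w - xi) q(w), so its inner product with K_xi is the same for
   t = 0 and t = 1; this is the reproducing property up to the factor <1, K_xi>,
   which the case xi = 0 evaluates to 1. *)

Require Import Defs.
From HB Require Import structures.
From mathcomp Require Import all_boot all_order all_algebra.
From mathcomp Require Import complex.
From mathcomp Require Import all_classical all_reals all_analysis.
From mathcomp Require Import measurable_realfun ring lra.

Set Implicit Arguments.
Unset Strict Implicit.
Unset Printing Implicit Defensive.

Import Order.TTheory GRing.Theory Num.Theory.
Import numFieldNormedType.Exports.

Local Open Scope classical_set_scope.
Local Open Scope ring_scope.
Local Open Scope complex_scope.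

Local Notation Re := (@complex.Re _).
Local Notation Im := (@complex.Im _).
(* As in [ring_scope] and in the definitions; [complex_scope] has [conjc]. *)
Local Notation "x ^*" := (Num.conj x) : complex_scope.

(** The obstacle is the range -1 < gamma < 0: there the weight is unbounded near the circle, and so
    are the partial derivatives to which the divergence theorem is applied. Hence nothing is assumed
    up to the boundary. The divergence theorem is proved on chords through Fubini, with a
    fundamental theorem of calculus for an integrand that is only integrable; the boundary terms
    vanish because the primitive is O((1 - |w|^2)^(gamma + 1)). Integrability on the disc always
    comes from domination by a multiple of the weight. The mass of the weight is found without polar
    coordinates: the area of a disc is linear in its squared radius, so |w|^2 carries plane measure
    to pi times length. Only bounded functions are paired and the reproducing property is proved for
    kernels alone, so no completeness, density or power series enters. The bases of all powers lie
    in the right half plane, where the principal argument is an arctangent and a power is a smooth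
    exponential of a logarithm. *)

Section ComplexPowers.
Context {R : realType}.
Implicit Types (z w d : R[i]) (r s t x y : R).

Definition cexp z : R[i] := (expR (Re z))%:C * (cos (Im z) +i* sin (Im z)).

(* The principal logarithm, on the right half plane only. *)
Definition clog z : R[i] := ln (Re z ^+ 2 + Im z ^+ 2) / 2 +i* atan (Im z / Re z).

(** Stands in for [cpow] on the right half plane: the laws in the exponent and the chain rule come
    from the exponential, which the [acos] form of the argument would obscure. *)
Definition rpow z r : R[i] := cexp (r%:C * clog z).

Lemma complexP z w : Re z = Re w -> Im z = Im w -> z = w.
Proof. by case: z w => [a b] [c d] /= -> ->. Qed.

Lemma ReM z w : Re (z * w) = Re z * Re w - Im z * Im w.
Proof. by case: z w => [a b] [c d]. Qed.

Lemma ImM z w : Im (z * w) = Re z * Im w + Im z * Re w.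
Proof. by case: z w => [a b] [c d]. Qed.

Lemma ReD z w : Re (z + w) = Re z + Re w.
Proof. by case: z w => [a b] [c d]. Qed.

Lemma ImD z w : Im (z + w) = Im z + Im w.
Proof. by case: z w => [a b] [c d]. Qed.

Lemma ReN z : Re (- z) = - Re z. Proof. by case: z. Qed.

Lemma ImN z : Im (- z) = - Im z. Proof. by case: z. Qed.

Lemma ReJ z : Re z^* = Re z. Proof. by case: z. Qed.

Lemma ImJ z : Im z^* = - Im z. Proof. by case: z. Qed.

Definition reimE := (ReM, ImM, ReD, ImD, ReN, ImN, ReJ, ImJ).

Lemma Re_cexp z : Re (cexp z) = expR (Re z) * cos (Im z).
Proof. by rewrite ReM /= mul0r subr0. Qed.

Lemma Im_cexp z : Im (cexp z) = expR (Re z) * sin (Im z).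
Proof. by rewrite ImM /= mul0r addr0. Qed.

Lemma cexpD z w : cexp (z + w) = cexp z * cexp w.
Proof.
by apply: complexP; rewrite /cexp !reimE /= expRD cosD sinD; ring.
Qed.

Lemma cexp0 : cexp 0 = 1.
Proof. by apply: complexP; rewrite /cexp !reimE /= expR0 cos0 sin0; ring. Qed.

Lemma normc_sqr z : normc z ^+ 2 = Re z ^+ 2 + Im z ^+ 2.
Proof. by case: z => a b; rewrite /= sqr_sqrtr// addr_ge0 ?sqr_ge0. Qed.

Lemma normc_ge0 z : 0 <= normc z.
Proof. by case: z => a b; rewrite /= sqrtr_ge0. Qed.

Lemma normc_lt1 z : (normc z < 1) = (Re z ^+ 2 + Im z ^+ 2 < 1).
Proof. by rewrite -normc_sqr expr_lt1 ?normc_ge0. Qed.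

Lemma normc_cexp z : normc (cexp z) = expR (Re z).
Proof.
apply/eqP; rewrite -(@eqrXn2 _ 2) ?normc_ge0 ?expR_ge0//; apply/eqP.
by rewrite normc_sqr /cexp !reimE /= -[RHS]mulr1 -(cos2Dsin2 (Im z)); ring.
Qed.

Lemma cexp_neq0 z : cexp z != 0.
Proof.
apply: contraTneq (expR_gt0 (Re z)) => z0.
by rewrite -normc_cexp z0 ComplexField.Normc.normc0 ltxx.
Qed.

Lemma cexpN z : cexp (- z) = (cexp z)^-1.
Proof.
by apply: (mulIf (cexp_neq0 z)); rewrite -cexpD addNr cexp0 mulVf ?cexp_neq0.
Qed.

Lemma normsq_gt0 z : 0 < Re z -> 0 < Re z ^+ 2 + Im z ^+ 2.
Proof. by move=> z0; rewrite ltr_wpDr ?sqr_ge0// exprn_gt0. Qed.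

Lemma normc_gt0 z : 0 < Re z -> 0 < normc z.
Proof. by move=> z0; case: z z0 => a b /= z0;
  rewrite sqrtr_gt0 (@normsq_gt0 (a +i* b)). Qed.

Lemma expR_half_ln x : 0 < x -> expR (ln x / 2) = Num.sqrt x.
Proof.
move=> x0; apply/eqP; rewrite -(@eqrXn2 _ 2) ?expR_ge0 ?sqrtr_ge0//.
by rewrite -expRM_natl mulrC divfK ?pnatr_eq0// lnK// sqr_sqrtr ?ltW.
Qed.

Lemma sqrt_slope z : 0 < Re z ->
  Num.sqrt (Re z ^+ 2 + Im z ^+ 2)
  = Re z * Num.sqrt (1 + (Im z / Re z) ^+ 2).
Proof.
move=> z0; rewrite -{2}(ger0_norm (ltW z0)) -sqrtr_sqr -sqrtrM ?sqr_ge0//.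
by congr Num.sqrt; field; rewrite gt_eqF.
Qed.

Lemma cos_arg z : 0 < Re z -> cos (atan (Im z / Re z)) = Re z / normc z.
Proof.
move=> z0; rewrite cos_atan.
have -> : normc z = Re z * Num.sqrt (1 + (Im z / Re z) ^+ 2).
  by rewrite -sqrt_slope//; case: z z0.
by rewrite invfM mulrA mulfV ?gt_eqF// mul1r.
Qed.

Lemma sin_arg z : 0 < Re z -> sin (atan (Im z / Re z)) = Im z / normc z.
Proof.
move=> z0; set t := atan _.
have c0 : cos t != 0.
  by rewrite /t cos_arg// gt_eqF// divr_gt0// normc_gt0.
have : tan t = Im z / Re z by rewrite /t atanK.
rewrite /tan => /(congr1 (fun x => x * cos t)); rewrite divfK// => ->.
by rewrite /t cos_arg//; field; rewrite !gt_eqF// normc_gt0.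
Qed.

Lemma cexp_clog z : 0 < Re z -> cexp (clog z) = z.
Proof.
move=> z0; have n0 := normc_gt0 z0.
have e : expR (ln (Re z ^+ 2 + Im z ^+ 2) / 2) = normc z.
  by rewrite expR_half_ln ?normsq_gt0//; case: (z).
apply: complexP; rewrite /cexp !reimE /clog /= e cos_arg// sin_arg//.
  by field; rewrite gt_eqF.
by field; rewrite gt_eqF.
Qed.

Lemma rpow_neq0 z r : rpow z r != 0.
Proof. exact: cexp_neq0. Qed.

Lemma rpowD z r s : rpow z (r + s) = rpow z r * rpow z s.
Proof. by rewrite /rpow -cexpD rmorphD mulrDl. Qed.

Lemma rpowN z r : rpow z (- r) = (rpow z r)^-1.
Proof. by rewrite /rpow rmorphN mulNr cexpN. Qed.

Lemma rpow1 z : 0 < Re z -> rpow z 1 = z.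
Proof. by move=> z0; rewrite /rpow mul1r cexp_clog. Qed.

Lemma rpow1n r : rpow 1 r = 1.
Proof.
have -> : 1 = 1 +i* 0 :> R[i] by [].
by rewrite /rpow /clog /= expr1n expr0n addr0 ln1 !mul0r atan0 mulr0 cexp0.
Qed.

Lemma normc_rpow z r : 0 < Re z -> normc (rpow z r) = normc z `^ r.
Proof.
move=> z0; rewrite normc_cexp !reimE /clog /= mul0r subr0.
rewrite /powR gt_eqF ?normc_gt0//; congr (expR (_ * _)).
by rewrite -[in RHS](cexp_clog z0) normc_cexp expRK.
Qed.

(** Both are arguments of [z]. The sign of [Im z] decides whether the arctangent lies in [0, pi] or
    in [- pi, 0], and [acos] inverts [cos] on the first interval and, up to sign, on the second. *)
Lemma carg_atan z : 0 < Re z -> carg z = atan (Im z / Re z).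
Proof.
move=> z0; rewrite /carg -cos_arg//; case: leP => i0.
  rewrite cosK// in_itv/=; apply/andP; split.
    by rewrite -atan0 le_atan// divr_ge0// ltW.
  rewrite (le_trans (ltW (atan_ltpi2 _)))//.
  by rewrite ler_pdivrMr// ler_peMr ?pi_ge0// ler1n.
rewrite cosKN ?opprK//; apply/andP; split.
  rewrite (le_trans _ (ltW (atan_gtNpi2 _)))// lerN2.
  by rewrite ler_pdivrMr// ler_peMr ?pi_ge0// ler1n.
by rewrite -atan0 le_atan// pmulr_lle0 ?invr_gt0// ltW.
Qed.

Lemma cpow_rpow z r : 0 < Re z -> cpow z r = rpow z r.
Proof.
move=> z0; rewrite /cpow -normc_rpow// normc_cexp /rpow /cexp carg_atan//.
by rewrite !reimE /clog /= !mul0r addr0.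
Qed.

Lemma normcM z w : normc (z * w) = normc z * normc w.
Proof. exact: ComplexField.Normc.normcM. Qed.

(** The hypotheses give cos (x - y) = 1, hence sin ((x - y) / 2) = 0 by the half-angle formula; and
    (x - y) / 2 lies in ]- pi, pi[, where the sine vanishes only at 0. *)
Lemma cos_sin_inj x y : - pi < x < pi -> - pi < y < pi ->
  cos x = cos y -> sin x = sin y -> x = y.
Proof.
move=> /andP[x1 x2] /andP[y1 y2] cxy sxy.
have c1 : cos (x - y) = 1 by rewrite cosB cxy sxy -!expr2 cos2Dsin2.
have s0 : sin ((x - y) / 2) = 0.
  have : cos ((x - y) / 2 *+ 2) = 1 by rewrite -mulr_natr divfK.
  rewrite cos_mulr2n cos2sin2 => h.
  have : sin ((x - y) / 2) ^+ 2 = 0 by rewrite mulr2n in h; lra.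
  by move/eqP; rewrite sqrf_eq0 => /eqP.
have [h|h|h] := ltgtP x y; last by [].
  have := @sin_gt0_pi R ((y - x) / 2).
  have -> : (y - x) / 2 = - ((x - y) / 2) by field.
  by rewrite sinN s0 oppr0 ltxx => H; exfalso; apply/notF/H; apply/andP; split; lra.
have := @sin_gt0_pi R ((x - y) / 2).
by rewrite s0 ltxx => H; exfalso; apply/notF/H; apply/andP; split; lra.
Qed.

(* Both sides are logarithms of the same number; the imaginary parts lie in
   ]-pi, pi[, being sums of two arguments in ]-pi/2, pi/2[. *)
Lemma clogD z1 z2 z3 z4 : 0 < Re z1 -> 0 < Re z2 -> 0 < Re z3 -> 0 < Re z4 ->
  z1 * z2 = z3 * z4 -> clog z1 + clog z2 = clog z3 + clog z4.
Proof.
move=> h1 h2 h3 h4 e.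
have E : cexp (clog z1 + clog z2) = cexp (clog z3 + clog z4).
  by rewrite !cexpD !cexp_clog.
have Er : Re (clog z1 + clog z2) = Re (clog z3 + clog z4).
  by apply: expR_inj; rewrite -!normc_cexp E.
have b z : - (pi / 2) < Im (clog z) < pi / 2.
  by rewrite /= atan_gtNpi2 atan_ltpi2.
apply: complexP => //; apply: cos_sin_inj.
- have /andP[? ?] := b z1; have /andP[? ?] := b z2.
  by rewrite ImD; apply/andP; split; lra.
- have /andP[? ?] := b z3; have /andP[? ?] := b z4.
  by rewrite ImD; apply/andP; split; lra.
- move/(congr1 Re): E; rewrite !Re_cexp Er.
  by move/mulfI; apply; rewrite gt_eqF ?expR_gt0.
- move/(congr1 Im): E; rewrite !Im_cexp Er.
  by move/mulfI; apply; rewrite gt_eqF ?expR_gt0.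
Qed.

(** Compares two products of powers instead of giving the power of a product: the common product may
    leave the right half plane, where [clog] is no longer a logarithm. *)
Lemma rpowM z1 z2 z3 z4 r : 0 < Re z1 -> 0 < Re z2 -> 0 < Re z3 -> 0 < Re z4 ->
  z1 * z2 = z3 * z4 -> rpow z1 r * rpow z2 r = rpow z3 r * rpow z4 r.
Proof. by move=> *; rewrite /rpow -!cexpD -!mulrDr (@clogD z1 z2 z3 z4). Qed.

Lemma rpow_real x r : 0 < x -> rpow x%:C r = (x `^ r)%:C.
Proof.
move=> x0; rewrite /rpow /clog /= expr0n addr0 mul0r atan0.
apply: complexP; rewrite /cexp !reimE /= ?mulr0 ?mul0r !subr0 ?addr0 ?sin0
  ?cos0 ?mulr0 ?mul0r //.
rewrite /powR gt_eqF// mulr1; congr expR.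
by rewrite lnXn// mulr2n -[_ / 2]/(_ * _); lra.
Qed.

End ComplexPowers.

(** * Derivatives of complex-valued functions of a real parameter *)

Section PathDerivative.
Context {R : realType}.
Implicit Types (f g : R -> R[i]) (t : R) (d e z : R[i]).

(** Differentiation is only ever needed along a real parameter: a slice of the disc, the deformation
    parameter of the kernel, a segment. Working by components gives direct access to the real mean
    value theorem and the fundamental theorem of calculus. *)
Definition is_cderive f t d :=
  is_derive t 1 (fun u => Re (f u)) (Re d) /\
  is_derive t 1 (fun u => Im (f u)) (Im d).

Lemma is_cderive_eq f t d e : is_cderive f t d -> d = e -> is_cderive f t e.
Proof. by move=> + <-. Qed.

Lemma is_derive1_congr (f g : R -> R) (x a b : R) :
  is_derive x 1 f a -> f =1 g -> a = b -> is_derive x 1 g b.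
Proof. by move=> + /funext <- <-. Qed.

Lemma is_cderive_cst z t : is_cderive (fun=> z) t 0.
Proof. by split; exact: is_derive_cst. Qed.

Lemma is_cderiveD f g t d e : is_cderive f t d -> is_cderive g t e ->
  is_cderive (fun u => f u + g u) t (d + e).
Proof.
move=> [f1 f2] [g1 g2]; split.
  by apply: (is_derive1_congr (is_deriveD f1 g1)) => [u|]; rewrite reimE.
by apply: (is_derive1_congr (is_deriveD f2 g2)) => [u|]; rewrite reimE.
Qed.

Lemma is_cderiveM f g t d e : is_cderive f t d -> is_cderive g t e ->
  is_cderive (fun u => f u * g u) t (d * g t + f t * e).
Proof.
move=> [f1 f2] [g1 g2]; split.
  apply: (is_derive1_congr (is_deriveB (is_deriveM f1 g1) (is_deriveM f2 g2))).
    by move=> u; rewrite reimE.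
  by rewrite !reimE /GRing.scale /=; ring.
apply: (is_derive1_congr (is_deriveD (is_deriveM f1 g2) (is_deriveM f2 g1))).
  by move=> u; rewrite reimE.
by rewrite !reimE /GRing.scale /=; ring.
Qed.

Lemma is_cderiveN f t d : is_cderive f t d ->
  is_cderive (fun u => - f u) t (- d).
Proof.
move=> [f1 f2]; split.
  by apply: (is_derive1_congr (is_deriveN f1)) => [u|]; rewrite reimE.
by apply: (is_derive1_congr (is_deriveN f2)) => [u|]; rewrite reimE.
Qed.

Lemma is_cderiveJ f t d : is_cderive f t d ->
  is_cderive (fun u => (f u)^*) t d^*.
Proof.
move=> [f1 f2]; split.
  by apply: (is_derive1_congr f1) => [u|]; rewrite reimE.
by apply: (is_derive1_congr (is_deriveN f2)) => [u|]; rewrite reimE.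
Qed.

Lemma is_cderive_id t : is_cderive (fun u => u%:C) t 1.
Proof. by split; [exact: is_derive_id|exact: is_derive_cst]. Qed.

Lemma is_cderive_cexp f t d : is_cderive f t d ->
  is_cderive (fun u => cexp (f u)) t (d * cexp (f t)).
Proof.
move=> [f1 f2].
have e1 := is_derive1_comp (is_derive_expR (Re (f t))) f1.
have c1 := is_derive1_comp (is_derive_cos (Im (f t))) f2.
have s1 := is_derive1_comp (is_derive_sin (Im (f t))) f2.
split.
  apply: (is_derive1_congr (is_deriveM e1 c1)) => [u|]; first by rewrite Re_cexp.
  by rewrite ReM Re_cexp Im_cexp /GRing.scale /=; ring.
apply: (is_derive1_congr (is_deriveM e1 s1)) => [u|]; first by rewrite Im_cexp.
by rewrite ImM Re_cexp Im_cexp /GRing.scale /=; ring.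
Qed.

Lemma Re_inv z : Re z^-1 = Re z / (Re z ^+ 2 + Im z ^+ 2).
Proof. by case: z. Qed.

Lemma Im_inv z : Im z^-1 = - Im z / (Re z ^+ 2 + Im z ^+ 2).
Proof. by case: z => a b /=; rewrite mulNr. Qed.

Lemma is_cderive_clog f t d : 0 < Re (f t) -> is_cderive f t d ->
  is_cderive (fun u => clog (f u)) t (d / f t).
Proof.
move=> f0 [f1 f2]; have n0 := normsq_gt0 f0.
have f0' : Re (f t) != 0 by rewrite gt_eqF.
split.
  have q := is_deriveD (is_deriveM f1 f1) (is_deriveM f2 f2).
  have n0' : 0 < ((fun u => Re (f u)) * (fun u => Re (f u))
           + (fun u => Im (f u)) * (fun u => Im (f u))) t.
    by move: n0; rewrite !expr2.
  have l := is_derive1_comp (is_derive1_ln n0') q.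
  apply: (is_derive1_congr (is_deriveM l (is_derive_cst (2^-1 : R) t 1))).
    by move=> u; rewrite /= -!expr2.
  rewrite ReM Re_inv Im_inv /GRing.scale /= /cst -!expr2 /=.
  have -> : ((fun u => Re (f u)) ^+ 2 + (fun u => Im (f u)) ^+ 2) t =
     Re (f t) ^+ 2 + Im (f t) ^+ 2 by [].
  by field; rewrite gt_eqF.
have v := is_deriveM f2 (is_deriveV f0' f1).
apply: (is_derive1_congr (is_derive1_comp (is_derive1_atan _) v)).
  by move=> u.
rewrite ImM Re_inv Im_inv /GRing.scale /=.
have -> : ((fun u => Im (f u)) * (fun u => (Re (f u))^-1)) t
   = Im (f t) / Re (f t) by [].
by field; rewrite f0' /= gt_eqF// addrC.
Qed.

Lemma is_cderive_rpow f t d (r : R) : 0 < Re (f t) -> is_cderive f t d ->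
  is_cderive (fun u => rpow (f u) r) t (r%:C * rpow (f t) (r - 1) * d).
Proof.
move=> f0 fd; have := is_cderiveM (is_cderive_cst r%:C t) (is_cderive_clog f0 fd).
move=> /is_cderive_cexp /is_cderive_eq; apply.
have e : f t != 0 by apply: contraTneq f0 => ->; rewrite ltxx.
rewrite -/(rpow (f t) r) rpowD rpowN (rpow1 f0); field; exact: e.
Qed.

Lemma is_cderive_continuous f t d : is_cderive f t d ->
  {for t, continuous (fun u => Re (f u))} /\
  {for t, continuous (fun u => Im (f u))}.
Proof.
by move=> [[f1 _] [f2 _]]; split; apply: differentiable_continuous;
  apply/derivable1_diffP.
Qed.

End PathDerivative.

(** * Measurability and elementary estimates *)

Section ComplexMeasurability.
Context {R : realType}.
Implicit Types (f g : R * R -> R[i]) (z w b : R[i]) (r : R).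
Local Notation T := (measurableTypeR R * measurableTypeR R)%type.

(** Stated on the whole plane: [rpow] is built from total measurable functions, so measurability
    composes without a side condition on the base. *)
Definition cmeasurable (f : R * R -> R[i]) :=
  measurable_fun [set: T] (fun p : T => Re (f p)) /\
  measurable_fun [set: T] (fun p : T => Im (f p)).

Lemma measurable_inv (h : T -> R) :
  measurable_fun [set: T] h -> measurable_fun [set: T] (fun p => (h p)^-1).
Proof.
(* The real power with exponent -1 is the inverse on nonnegative numbers, hence the square. At a
   zero of [h] both sides are 0. *)
move=> mh; have -> : (fun p => (h p)^-1) = h \* (fun p => (h p ^+ 2) `^ (-1)).
  apply/funext => p /=; rewrite powR_inv1 ?sqr_ge0//.
  have [->|h0] := eqVneq (h p) 0; first by rewrite mul0r invr0.
  by rewrite expr2 invfM mulrA mulfV// mul1r.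
apply: measurable_funM => //.
apply: (measurableT_comp (measurable_powR (-1))).
exact: measurable_funX.
Qed.

Lemma cmeasurable_cst z : cmeasurable (fun=> z).
Proof. by split; exact: measurable_cst. Qed.

Lemma cmeasurable_cplx : cmeasurable (@cplx R).
Proof. by split; [exact: measurable_fst|exact: measurable_snd]. Qed.

Lemma cmeasurableD f g : cmeasurable f -> cmeasurable g ->
  cmeasurable (fun p => f p + g p).
Proof.
move=> [f1 f2] [g1 g2]; split.
  by under eq_fun do rewrite reimE; exact: measurable_funD.
by under eq_fun do rewrite reimE; exact: measurable_funD.
Qed.

Lemma cmeasurableM f g : cmeasurable f -> cmeasurable g ->
  cmeasurable (fun p => f p * g p).
Proof.
move=> [f1 f2] [g1 g2]; split.
  by under eq_fun do rewrite reimE;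
    apply: measurable_funB; exact: measurable_funM.
by under eq_fun do rewrite reimE;
  apply: measurable_funD; exact: measurable_funM.
Qed.

Lemma cmeasurableN f : cmeasurable f -> cmeasurable (fun p => - f p).
Proof.
move=> [f1 f2]; split.
  by under eq_fun do rewrite reimE; exact: measurable_funN.
by under eq_fun do rewrite reimE; exact: measurable_funN.
Qed.

Lemma cmeasurableJ f : cmeasurable f -> cmeasurable (fun p => (f p)^*).
Proof.
move=> [f1 f2]; split.
  by under eq_fun do rewrite reimE.
by under eq_fun do rewrite reimE; exact: measurable_funN.
Qed.

Lemma cmeasurable_cexp f : cmeasurable f -> cmeasurable (fun p => cexp (f p)).
Proof.
move=> [f1 f2]; split.
  under eq_fun do rewrite Re_cexp; apply: measurable_funM.
    exact: measurableT_comp.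
  apply: measurableT_comp => //.
  by apply: continuous_measurable_fun; exact: continuous_cos.
under eq_fun do rewrite Im_cexp; apply: measurable_funM.
  exact: measurableT_comp.
apply: measurableT_comp => //.
by apply: continuous_measurable_fun; exact: continuous_sin.
Qed.

Lemma cmeasurable_rpow f r : cmeasurable f -> cmeasurable (fun p => rpow (f p) r).
Proof.
move=> [f1 f2]; apply: cmeasurable_cexp; apply: cmeasurableM.
  exact: cmeasurable_cst.
split => /=.
  apply: measurable_funM; last exact: measurable_cst.
  apply: (measurableT_comp (@measurable_ln R)).
  by apply: measurable_funD; exact: measurable_funX.
apply: measurableT_comp.
  by apply: continuous_measurable_fun => x; exact: continuous_atan.
by apply: measurable_funM => //; exact: measurable_inv.
Qed.

Lemma measurable_normc f : cmeasurable f ->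
  measurable_fun [set: T] (fun p => normc (f p)).
Proof.
move=> [f1 f2].
have -> : (fun p => normc (f p)) = (fun p =>
  (Re (f p) ^+ 2 + Im (f p) ^+ 2) `^ 2^-1).
  by apply/funext => p; rewrite powR12_sqrt ?addr_ge0 ?sqr_ge0//; case: (f p).
apply: (measurableT_comp (measurable_powR 2^-1)).
by apply: measurable_funD; exact: measurable_funX.
Qed.

Definition pdisc : set T := @cplx R @^-1` disc.

Lemma measurable_pdisc : measurable pdisc.
Proof.
rewrite -[pdisc]setTI.
have := measurable_fun_ltr (measurable_normc cmeasurable_cplx)
  (@measurable_cst _ _ T (measurableTypeR R) setT (1 : R)).
move=> /(_ measurableT [set true] Logic.I).
by congr (measurable (_ `&` _)); apply/seteqP; split => p /=.
Qed.

Lemma mulJ_normc z : z * z^* = (normc z ^+ 2)%:C.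
Proof. by rewrite normc_sqr; apply: complexP; rewrite !reimE /=; ring. Qed.

Lemma pdiscE (p : T) : pdisc p = (p.1 ^+ 2 + p.2 ^+ 2 < 1) :> Prop.
Proof. by rewrite /pdisc /disc /= -[Num.sqrt _]/(normc (cplx p)) normc_lt1. Qed.

Lemma abs_Re_le z : `|Re z| <= normc z.
Proof.
rewrite -(@ler_pXn2r _ 2) ?nnegrE ?normc_ge0//.
by rewrite real_normK ?num_real// normc_sqr lerDl sqr_ge0.
Qed.

Lemma abs_Im_le z : `|Im z| <= normc z.
Proof.
rewrite -(@ler_pXn2r _ 2) ?nnegrE ?normc_ge0//.
by rewrite real_normK ?num_real// normc_sqr lerDr sqr_ge0.
Qed.

Lemma normcJ z : normc z^* = normc z.
Proof. by case: z => a b /=; rewrite sqrrN. Qed.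

Lemma normcD z w : normc (z + w) <= normc z + normc w.
Proof. exact: (@le_normcD R). Qed.

Lemma normcN z : normc (- z) = normc z.
Proof. by case: z => a b /=; rewrite !sqrrN. Qed.

Lemma normc_real r : normc r%:C = `|r|.
Proof. by rewrite /= expr0n addr0 sqrtr_sqr. Qed.

Lemma Re_1sub b w (rho : R) : normc b <= rho -> normc w <= 1 ->
  1 - rho <= Re (1 - b * w).
Proof.
move=> hb hw; rewrite ReD ReN lerD2l lerN2.
apply: le_trans (ler_norm _) _; apply: le_trans (abs_Re_le _) _.
by rewrite normcM -[rho]mulr1 ler_pM ?normc_ge0.
Qed.

Lemma Re_1sub_gt0 b w : normc b < 1 -> normc w <= 1 -> 0 < Re (1 - b * w).
Proof.
by move=> hb hw; apply: lt_le_trans (Re_1sub (lexx _) hw); rewrite subr_gt0.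
Qed.

Lemma normc_1sub_le b w : normc b <= 1 -> normc w <= 1 -> normc (1 - b * w) <= 2.
Proof.
move=> hb hw; apply: le_trans (normcD _ _) _.
rewrite normcN normcM (@normc_real 1) normr1 -[2]/(1 + 1) lerD2l.
by rewrite mulr_ile1 ?normc_ge0.
Qed.

(** Writing the power as exp (r ln x), with [ln x] between [ln a] and [ln c], gives one crude bound
    for both signs of [r]. *)
Lemma powR_le_bound (x a c r : R) : 0 < a -> a <= x <= c ->
  x `^ r <= expR (`|r| * (`|ln a| + `|ln c|)).
Proof.
move=> a0 /andP[ax xc]; have x0 : 0 < x by exact: lt_le_trans ax.
rewrite /powR gt_eqF// ler_expR; apply: le_trans (ler_norm _) _.
have la : ln a <= ln x by rewrite ler_ln ?posrE.
have lc : ln x <= ln c by rewrite ler_ln ?posrE ?(lt_le_trans x0).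
rewrite normrM ler_wpM2l// ler_norml; apply/andP; split.
  have := ler_norm (- ln a); rewrite normrN => ?; have := normr_ge0 (ln c); lra.
have := ler_norm (ln c); have := normr_ge0 (ln a); lra.
Qed.

End ComplexMeasurability.

(** * The fundamental theorem of calculus for integrands singular at the endpoints *)

Section ImproperFTC.
Context {R : realType}.
Notation mu := (@lebesgue_measure R).

(** The usual theorem on compact subintervals shows that [F] differs by a constant from the
    indefinite integral [I]. Integrability alone makes [I] converge to its values at [a] and [b], so
    the one-sided limits of [F] give the result. *)
Lemma integrable_FTC2 (f F : R -> R) (a b la lb : R) : a < b ->
  mu.-integrable `[a, b] (EFin \o f) ->
  (forall x, x \in `]a, b[ -> {for x, continuous f}) ->
  (forall x, x \in `]a, b[ -> is_derive x 1 F (f x)) ->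
  F x @[x --> a^'+] --> la -> F x @[x --> b^'-] --> lb ->
  \int[mu]_(x in `[a, b]) f x = lb - la.
Proof.
move=> ab intf cf dF Fa Fb; pose I x := \int[mu]_(t in `[a, x]) f t.
have FI x y : x \in `]a, b[ -> y \in `]a, b[ -> x < y -> F y - F x = I y - I x.
  move=> xab yab xy.
  have sub z : z \in `[x, y] -> z \in `]a, b[.
    by apply: subset_itvSoo; rewrite bnd_simp ?(itvP xab) ?(itvP yab).
  have int1 : mu.-integrable `[a, y] (EFin \o f).
    apply: integrableS intf => //; apply: subset_itvl.
    by rewrite bnd_simp (itvP yab).
  rewrite /I Rintegral_itvB//; last 2 first.
    by rewrite bnd_simp (itvP xab).
    by rewrite bnd_simp ltW.
  rewrite Rintegral_itv_obnd_cbnd; last first.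
    apply: integrableS int1 => //; apply: subset_itvr.
    by rewrite bnd_simp (itvP xab).
  rewrite /Rintegral (@continuous_FTC2 _ f F)//.
  - by apply: continuous_in_subspaceT => z; rewrite inE => /sub/cf.
  - split.
    + by move=> z zxy; have [] := dF z (sub _ (subset_itv_oo_cc zxy)).
    + apply: cvg_at_right_filter; apply: differentiable_continuous.
      by apply/derivable1_diffP; have [] := dF x xab.
    + apply: cvg_at_left_filter; apply: differentiable_continuous.
      by apply/derivable1_diffP; have [] := dF y yab.
  - move=> z zxy; rewrite derive1E.
    by have [_ ->] := dF z (sub _ (subset_itv_oo_cc zxy)).
pose c := (a + b) / 2.
have cab : c \in `]a, b[ by rewrite in_itv/= !midf_lt.
have FE x : x \in `]a, b[ -> F x = I x + (F c - I c).
  move=> xab; have [xc|xc|->] := ltgtP x c; last by ring.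
    by have := FI _ _ xab cab xc; lra.
  by have := FI _ _ cab xab xc; lra.
have Ia : I x @[x --> a^'+] --> 0.
  by apply: cvg_at_right_filter; exact: (parameterized_integral_cvg_left ab).
have Ib : I x @[x --> b^'-] --> I b by exact: parameterized_integral_cvg_at_left.
have -> : la = 0 + (F c - I c).
  apply: (cvg_unique _ Fa); first exact: norm_hausdorff.
  apply: cvg_trans (cvgD Ia (cvg_cst (F c - I c))); apply: near_eq_cvg.
  near=> x; rewrite [RHS]FE// in_itv/=; apply/andP; split; first by near: x;
    exact: nbhs_right_gt.
  by near: x; exact: nbhs_right_lt.
have -> : lb = I b + (F c - I c).
  apply: (cvg_unique _ Fb); first exact: norm_hausdorff.
  apply: cvg_trans (cvgD Ib (cvg_cst (F c - I c))); apply: near_eq_cvg.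
  near=> x; rewrite [RHS]FE// in_itv/=; apply/andP; split; last by near: x;
    exact: nbhs_left_lt.
  by near: x; exact: nbhs_left_gt.
by rewrite /I; ring.
Unshelve. all: by end_near. Qed.

(* The bound by a power of the weight makes the boundary terms vanish. *)
Lemma Rintegral_chord0 (f F : R -> R) (m K s : R) : 0 < m -> 0 < s ->
  mu.-integrable `[- Num.sqrt m, Num.sqrt m] (EFin \o f) ->
  (forall x, x ^+ 2 < m -> {for x, continuous f}) ->
  (forall x, x ^+ 2 < m -> is_derive x 1 F (f x)) ->
  (forall x, x ^+ 2 < m -> `|F x| <= K * (m - x ^+ 2) `^ s) ->
  \int[mu]_(x in `[- Num.sqrt m, Num.sqrt m]) f x = 0.
Proof.
move=> m0 s0 intf cf dF Fb; set b := Num.sqrt m.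
have b0 : 0 < b by rewrite sqrtr_gt0.
have bE : b ^+ 2 = m by rewrite sqr_sqrtr// ltW.
have itvE x : x \in `]- b, b[ -> x ^+ 2 < m.
  by rewrite in_itv/= -ltr_norml => h; rewrite -bE -real_normK ?num_real//
    ltr_pXn2r ?nnegrE// ltW.
have wE (e : R) : e ^+ 2 = m -> (m - x ^+ 2) @[x --> e] --> 0.
  move=> eE; have -> : 0 = m - e ^+ 2 by rewrite eE subrr.
  by apply: cvgB; [exact: cvg_cst|exact: exprn_continuous].
(* One statement for both endpoints. Staying in the open interval makes the weight tend to 0 from
   the right, which is where its power [s] is known to tend to 0. *)
have P0 (G : set_system R) (FG : ProperFilter G) : (\forall x \near G, x \in
  `]- b, b[) ->
    (m - x ^+ 2) @[x --> G] --> 0 -> F x @[x --> G] --> 0.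
  move=> nG wG; apply/norm_cvg0P.
  have H : (K * (m - x ^+ 2) `^ s) @[x --> G] --> 0.
    rewrite -[X in _ --> X](mulr0 K); apply: cvgM; first exact: cvg_cst.
    have : (m - x ^+ 2) @[x --> G] --> 0^'+.
      move=> A [e e0 eA]; suff : \forall x \near G, A (m - x ^+ 2) by [].
      move/cvgrPdist_lt/(_ _ e0) : wG => wG; near=> x; apply: eA => /=.
        by near: x.
      by rewrite subr_gt0 itvE//; near: x.
    by move/cvg_comp => h; exact: (h _ _ _ (powR_cvg0 s0)).
  apply: (squeeze_cvgr _ (cvg_cst 0) H); near=> x.
  by rewrite normr_ge0/= Fb// itvE//; near: x.
rewrite -[RHS](subrr 0); apply: (@integrable_FTC2 f F) => //.
- by rewrite gtrN.
- by move=> x /itvE/cf.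
- by move=> x /itvE/dF.
- apply: P0; last by apply: cvg_at_right_filter; apply: wE; rewrite sqrrN.
  near=> x; rewrite in_itv/=; apply/andP; split; first by near: x;
    exact: nbhs_right_gt.
  by near: x; apply: nbhs_right_lt; rewrite gtrN.
- apply: P0; last by apply: cvg_at_left_filter; apply: wE.
  near=> x; rewrite in_itv/=; apply/andP; split; last by near: x;
    exact: nbhs_left_lt.
  by near: x; apply: nbhs_left_gt; rewrite gtrN.
Unshelve. all: by end_near. Qed.

End ImproperFTC.

(** * Vanishing integrals of partial derivatives over the disc *)

Section Stokes.
Context {R : realType}.
Notation mu := (@lebesgue_measure R).
Local Notation T := (measurableTypeR R * measurableTypeR R)%type.
Notation lebesgue2 := (@lebesgue2 R).

(** [D] is a chord of the disc in a coordinate direction and [m] the square of its half-length. The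
    integrand is extended by 0 because this is the form in which Fubini delivers it. *)
Lemma integral_slice0 (D : set R) (h F : R -> R) (m K s : R) :
  (forall x, D x = (x ^+ 2 < m) :> Prop) -> 0 < s ->
  mu.-integrable setT ((EFin \o h) \_ D) ->
  (forall x, D x -> {for x, continuous h}) ->
  (forall x, D x -> is_derive x 1 F (h x)) ->
  (forall x, D x -> `|F x| <= K * (m - x ^+ 2) `^ s) ->
  (\int[mu]_x ((EFin \o h) \_ D) x = 0)%E.
Proof.
move=> DE s0; rewrite restrict_EFin => ih ch dh Fh.
(* The line misses the open disc: the chord is empty. *)
have [m0|m0] := leP m 0.
  apply: integral0_eq => x _; rewrite /= patchE ifF//; apply/negbTE/negP.
  by rewrite inE DE => /lt_le_trans/(_ m0); rewrite ltNge sqr_ge0.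
have ic : mu.-integrable `[- Num.sqrt m, Num.sqrt m] (EFin \o (h \_ D)).
  exact: integrableS ih.
have DE' x : x ^+ 2 < m -> x \in D by rewrite inE DE.
have H := @Rintegral_chord0 _ (h \_ D) F m K s m0 s0 ic.
have Ieq : (\int[mu]_x (EFin \o h \_ D) x = \int[mu]_(x in `[(- Num.sqrt m)%R,
  Num.sqrt m]) (EFin \o h \_ D) x)%E.
  rewrite [RHS]integral_mkcond; apply: eq_integral => x _.
  rewrite [RHS]patchE; case: ifPn => // /negP; rewrite inE/= => xm.
  rewrite /= patchE ifF//; apply/negbTE/negP; rewrite inE DE => xm'; apply: xm.
  rewrite in_itv/= -ler_norml -(@ler_pXn2r _ 2) ?nnegrE ?sqrtr_ge0//.
  by rewrite real_normK ?num_real// sqr_sqrtr ltW.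
rewrite Ieq -[LHS]fineK; last exact: integrable_fin_num.
rewrite [fine _]H// => x xm.
(* The chord is open, so near an interior point the extension by 0 coincides with [h] and inherits
   its continuity. *)
- have ox : \forall u \near x, u ^+ 2 < m.
    have c : u ^+ 2 @[u --> x] --> x ^+ 2 by exact: exprn_continuous.
    exact: (cvgr_lt _ c _ xm).
  have -> : {for x, continuous (h \_ D)} = (h u @[u --> x] --> h x) :> Prop.
    rewrite /prop_for /continuous_at patchE DE'//.
    apply/propext; split; apply: cvg_trans; apply: near_eq_cvg; near=> u;
      by rewrite patchE DE'//; near: u.
  by apply: ch; rewrite DE.
- by rewrite patchE DE'//; apply: dh; rewrite DE.
- by apply: Fh; rewrite DE.
Unshelve. all: by end_near. Qed.

Variables (e e1 : T -> R) (K s : R).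
Hypothesis s0 : 0 < s.
Hypothesis ie1 : lebesgue2.-integrable pdisc (EFin \o e1).
Hypothesis eb : forall p, pdisc p -> `|e p| <= K * (1 - (p.1 ^+ 2 + p.2 ^+ 2)) `^ s.

Let ig : lebesgue2.-integrable setT ((EFin \o e1) \_ pdisc).
Proof. by apply/integrable_restrict => //; [exact: measurable_pdisc|rewrite
  setTI]. Qed.

(** By Fubini it suffices that almost every horizontal slice integrates to 0; integrability of [e1]
    on the disc yields integrable slices only almost everywhere. On the slice at height [y] the
    bound on [e] is a power of (1 - y^2) - x^2. *)
Lemma Rintegral_partial1_disc0 :
  (forall x y, pdisc (x, y) -> {for x, continuous (fun u => e1 (u, y))}) ->
  (forall x y, pdisc (x, y) -> is_derive x 1 (fun u => e (u, y)) (e1 (x, y))) ->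
  Rintegral lebesgue2 pdisc e1 = 0.
Proof.
move=> ce1 de; rewrite /Rintegral integral_mkcond.
rewrite -(integral21_prod_meas1 ig).
rewrite (@ae_eq_integral _ _ _ _ setT (cst 0%E)) ?integral0//=.
- exact: (measurable_fubini_G ig).
- apply: filterS (ae_integrable2 ig) => y iy _.
  rewrite /fubini_G.
  have E : (fun x => ((EFin \o e1) \_ pdisc) (x, y)) =
      (EFin \o (fun x => e1 (x, y))) \_ [set x | pdisc (x, y)].
    by apply/funext => x; rewrite !patchE; congr (if _ then _ else _);
      apply/idP/idP; rewrite !inE.
  rewrite E; rewrite E in iy.
  apply: (@integral_slice0 _ _ (fun x => e (x, y)) (1 - y ^+ 2) K s) => //=.
  + by move=> x; rewrite pdiscE /= ltrBrDr.
  + by move=> x /ce1.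
  + by move=> x /eb /=; rewrite opprD addrA addrAC.
Qed.

Lemma Rintegral_partial2_disc0 :
  (forall x y, pdisc (x, y) -> {for y, continuous (fun u => e1 (x, u))}) ->
  (forall x y, pdisc (x, y) -> is_derive y 1 (fun u => e (x, u)) (e1 (x, y))) ->
  Rintegral lebesgue2 pdisc e1 = 0.
Proof.
move=> ce1 de; rewrite /Rintegral integral_mkcond.
rewrite -(integral12_prod_meas1 ig).
rewrite (@ae_eq_integral _ _ _ _ setT (cst 0%E)) ?integral0//=.
- exact: (measurable_fubini_F ig).
- apply: filterS (ae_integrable1 ig) => x ix _.
  rewrite /fubini_F.
  have E : (fun y => ((EFin \o e1) \_ pdisc) (x, y)) =
      (EFin \o (fun y => e1 (x, y))) \_ [set y | pdisc (x, y)].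
    by apply/funext => y; rewrite !patchE; congr (if _ then _ else _);
      apply/idP/idP; rewrite !inE.
  rewrite E; rewrite E in ix.
  apply: (@integral_slice0 _ _ (fun y => e (x, y)) (1 - x ^+ 2) K s) => //=.
  + by move=> y; rewrite pdiscE /= ltrBrDl.
  + by move=> y /ce1.
  + by move=> y /eb /=; rewrite opprD addrA.
Qed.

End Stokes.

(** * Radial integrals from the area of discs *)

Section RadialIntegration.
Context {R : realType}.
Notation mu := (@lebesgue_measure R).
Local Notation T := (measurableTypeR R * measurableTypeR R)%type.
Notation lebesgue2 := (@lebesgue2 R).

(** Substituting x = r sin t turns the integrand into 2 (r cos t)^2, with primitive r^2 (t + sin t
    cos t). *)
Lemma integral_semicircle (r : R) : 0 < r ->
  (\int[mu]_(x in `[(- r)%R, r]) (2 * Num.sqrt (r ^+ 2 - x ^+ 2))%:E =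
    (pi * r ^+ 2)%:E)%E.
Proof.
move=> r0; pose F (t : R) := r * sin t.
have dF (t : R) : is_derive t 1 F (r * cos t).
  apply: (is_derive1_congr (is_deriveM (is_derive_cst r t 1) (is_derive_sin t))).
    by [].
  by rewrite /GRing.scale /= /cst /=; ring.
have pi0 := @pi_gt0 R.
have ab : - (pi / 2) < pi / 2 :> R by rewrite gtrN// divr_gt0.
have F'E : derive1 F = (fun t => r * cos t).
  by apply/funext => t; rewrite derive1E; have [_ ->] := dF t.
have cF' : continuous (derive1 F).
  rewrite F'E => t; apply: cvgM; first exact: cvg_cst.
  exact: continuous_cos.
have cF : continuous F.
  by move=> t; apply: differentiable_continuous; apply/derivable1_diffP;
    have [] := dF t.
have Fa : F (- (pi / 2)) = - r by rewrite /F sinN sin_pihalf mulrN1.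
have Fb : F (pi / 2) = r by rewrite /F sin_pihalf mulr1.
rewrite -{1}Fa -{1}Fb.
rewrite (@integration_by_substitution_increasing _ F (fun x =>
  2 * Num.sqrt (r ^+ 2 - x ^+ 2))) ?ltW//; last first.
- apply: continuous_subspaceT => x; apply: cvgM; first exact: cvg_cst.
  apply: continuous_comp; last exact: sqrt_continuous.
  by apply: cvgB; [exact: cvg_cst|exact: exprn_continuous].
- by split => [t _||]; [have [] := dF t|exact: cvg_at_right_filter (cF
  _)|exact: cvg_at_left_filter (cF _)].
- by apply/cvg_ex; eexists; apply: cvg_at_left_filter; exact: cF'.
- by apply/cvg_ex; eexists; apply: cvg_at_right_filter; exact: cF'.
- by move=> x y xab yab xy; rewrite /F ltr_pM2l// ltr_sin.
have cosE (t : R) : t \in `[(- (pi / 2))%R, (pi / 2)%R] ->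
  Num.sqrt (r ^+ 2 - F t ^+ 2) = r * cos t.
  move=> tab; have -> : r ^+ 2 - F t ^+ 2 = (r * cos t) ^+ 2.
    by rewrite /F !exprMn cos2sin2; ring.
  by rewrite sqrtr_sqr ger0_norm// mulr_ge0 ?(ltW r0)// cos_ge0_pihalf.
have -> : (\int[mu]_(x in `[(- (pi / 2))%R, (pi / 2)%R]) ((((fun x =>
  2 * Num.sqrt (r ^+ 2 - x ^+ 2)) \o F) * derive1 F) x)%:E
  = \int[mu]_(x in `[(- (pi / 2))%R, (pi / 2)%R]) (2 * (r * cos x) ^+ 2)%:E)%E.
  apply: eq_integral => t; rewrite inE => tab; congr EFin.
  transitivity (2 * Num.sqrt (r ^+ 2 - F t ^+ 2) * (r * cos t)).
    by rewrite -[r * cos t]/((fun t => r * cos t) t) -F'E.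
  by rewrite cosE// expr2 mulrA.
pose G (t : R) := r ^+ 2 * (t + sin t * cos t).
have dG (t : R) : is_derive t 1 G (2 * (r * cos t) ^+ 2).
  have := is_deriveM (is_derive_cst (r ^+ 2) t 1)
    (is_deriveD (is_derive_id t 1) (is_deriveM (is_derive_sin t) (is_derive_cos
      t))).
  move/is_derive1_congr; apply => //.
  rewrite /GRing.scale /= /cst /= exprMn mulr0 addr0.
  by have := sin2cos2 t; rewrite !expr2 => s; ring: s.
have cG : continuous G.
  by move=> t; apply: differentiable_continuous; apply/derivable1_diffP;
    have [] := dG t.
rewrite (@continuous_FTC2 _ _ G)//.
- rewrite /G sinN sin_pihalf cosN cos_pihalf !mulr0 -EFinB; congr EFin; by field.
- apply: continuous_subspaceT => x; apply: cvgM; first exact: cvg_cst.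
  apply: (@cvg_comp _ _ _ _ (fun y : R => y ^+ 2)); last exact: exprn_continuous.
  by apply: cvgM; [exact: cvg_cst|exact: continuous_cos].
- by split => [t _||]; [have [] := dG t|exact: cvg_at_right_filter (cG
  _)|exact: cvg_at_left_filter (cG _)].
- by move=> t _; rewrite derive1E; have [_ ->] := dG t.
Qed.

Definition sqn (p : T) : R := p.1 ^+ 2 + p.2 ^+ 2.

Lemma measurable_sqn : measurable_fun [set: T] (sqn : T -> measurableTypeR R).
Proof.
by apply: measurable_funD; apply: measurable_funX;
  [exact: measurable_fst|exact: measurable_snd].
Qed.

(** The section at [x] has length 2 sqrt(c - x^2). As the square root of a negative number is 0
    here, this also covers empty sections, and the integral can run over the whole line. *)
Lemma disc_area (c : R) : lebesgue2 [set p | sqn p <= c] = (pi * Num.max c 0)%:E.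
Proof.
have -> : lebesgue2 [set p | sqn p <= c] =
    (\int[mu]_x (2 * Num.sqrt (c - x ^+ 2))%:E)%E.
  apply: eq_integral => x _ /=.
  have -> : xsection [set p | sqn p <= c] x = [set y | y ^+ 2 <= c - x ^+ 2].
    by apply/seteqP; split => y /=; rewrite /xsection /= inE /sqn /= lerBrDl.
  have [cx|cx] := ltP (c - x ^+ 2) 0.
    rewrite ltr0_sqrtr// mulr0 [X in mu X](_ : _ = set0) ?measure0//.
    apply/seteqP; split => y //=; rewrite leNgt => /negP; apply.
    by rewrite (lt_le_trans cx)// sqr_ge0.
  have -> : [set y | y ^+ 2 <= c - x ^+ 2] =
      `[- Num.sqrt (c - x ^+ 2), Num.sqrt (c - x ^+ 2)]%classic.
    apply/seteqP; split => y /=; rewrite in_itv/= -ler_norml.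
      by rewrite -{1}(sqr_sqrtr cx) -(real_normK (num_real y)) ler_pXn2r
        ?nnegrE ?sqrtr_ge0.
    by rewrite -{2}(sqr_sqrtr cx) -(real_normK (num_real y)) ler_pXn2r ?nnegrE
      ?sqrtr_ge0.
  rewrite lebesgue_measure_itv/= lte_fin; case: ltP => h.
    by rewrite -EFinB; congr EFin; ring.
  have := sqrtr_ge0 (c - x ^+ 2) => h'.
  by congr EFin; lra.
have [c0|c0] := leP c 0.
  rewrite mulr0 integral0_eq// => x _; rewrite ler0_sqrtr ?mulr0//.
  by rewrite subr_le0 (le_trans c0)// sqr_ge0.
have r0 : 0 < Num.sqrt c by rewrite sqrtr_gt0.
rewrite -{2}(sqr_sqrtr (ltW c0)) -integral_semicircle// [RHS]integral_mkcond.
apply: eq_integral => x _; rewrite [RHS]patchE; case: ifPn => [_|/negP].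
  by rewrite (sqr_sqrtr (ltW c0)).
rewrite inE/= in_itv/= -ler_norml => h; rewrite ler0_sqrtr ?mulr0//.
rewrite subr_le0 -(sqr_sqrtr (ltW c0)) -(real_normK (num_real x)).
by rewrite ler_pXn2r ?nnegrE ?sqrtr_ge0// ltW// ltNge; apply/negP.
Qed.


Let mradial (A : set (measurableTypeR R)) :
  measurable A -> measurable (sqn @^-1` A).
Proof. by move=> mA; rewrite -[X in measurable X]setTI; exact: measurable_sqn. Qed.

(* The image of the plane measure under the squared modulus, renormalized and
   completed by Lebesgue measure on the negative half line. *)
Definition radial (A : set (measurableTypeR R)) : \bar R :=
  ((pi^-1)%:E * (mu \x mu) (sqn @^-1` A) + mu (A `&` `]-oo, 0%R]))%E.

Let radialE A : radial A =
  ((pi^-1)%:E * (mu \x mu) (sqn @^-1` A) + mu (A `&` `]-oo, 0%R]))%E.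
Proof. by []. Qed.

Let radial0 : radial set0 = 0.
Proof. by rewrite /radial preimage_set0 set0I !measure0 mule0 adde0. Qed.

Let pi_inv_ge0 : 0 <= pi^-1 :> R.
Proof. by rewrite invr_ge0 pi_ge0. Qed.

Let radial_ge0 A : (0 <= radial A)%E.
Proof. by rewrite adde_ge0 ?mule_ge0. Qed.

Let radial_sigma_additive : semi_sigma_additive radial.
Proof.
have mN : measurable (`]-oo, 0%R] : set (measurableTypeR R)) by [].
pose k : {nonneg R} := NngNum pi_inv_ge0.
pose m1 : {measure set (measurableTypeR R) -> \bar R} :=
  mscale k (measure_function_pushforward__canonical__measure_function_Measure
    (mu \x mu)%E measurable_sqn).
pose m2 : {measure set (measurableTypeR R) -> \bar R} := mrestr mu mN.
have -> : radial = measure_add m1 m2.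
  by apply/funext => A; rewrite measure_addE.
exact: measure_semi_sigma_additive.
Qed.

HB.instance Definition _ := isMeasure.Build _ (measurableTypeR R) _ radial
  radial0 radial_ge0 radial_sigma_additive.

Let area_annulus (a b : R) : a < b ->
  ((mu \x mu) (sqn @^-1` `]a, b]) = (pi * (Num.max b 0 - Num.max a 0))%:E)%E.
Proof.
move=> ab.
have -> : sqn @^-1` `]a, b] = [set p | sqn p <= b] `\` [set p | sqn p <= a].
  apply/seteqP; split => p /=; rewrite in_itv/=.
    by move=> /andP[pa pb]; split => //; apply/negP; rewrite -ltNge.
  by move=> [pb /negP]; rewrite -ltNge => ->.
have mc c : measurable [set p : T | sqn p <= c].
  have -> : [set p : T | sqn p <= c] = sqn @^-1` `]-oo, c].
    by apply/seteqP; split => p /=; rewrite in_itv.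
  exact: mradial.
rewrite measureD//; last first.
  by rewrite -[X in (X < _)%E]/(lebesgue2 [set p | (sqn p <= b)%R]) disc_area ltry.
rewrite setIidr; last by move=> p /= /le_trans; apply; exact: ltW.
rewrite -[LHS]/(lebesgue2 [set p | (sqn p <= b)%R] -
  lebesgue2 [set p | (sqn p <= a)%R])%E.
by rewrite !disc_area -EFinB; congr EFin; ring.
Qed.

(** Lebesgue measure is determined by its values on the intervals ]a, b]. The annulus contributes
    max(b, 0) - max(a, 0), and the summand on the negative half line restores the part of the
    interval below 0. *)
Lemma radial_lebesgue (A : set (measurableTypeR R)) :
  measurable A -> mu A = radial A.
Proof.
have H := @lebesgue_measure_unique R (radial : {measure set (measurableTypeR R)
  -> \bar R}).
move=> mA; apply: H => // {mA A}.
move=> _ [[a b] _ <-]; rewrite -[RHS]/(radial `]a, b]) radialE.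
have [ab|ab] := ltP a b; last first.
  by rewrite (@set_itv_ge _ _ (BRight a) (BRight b)) -?leNgt ?bnd_simp//
    preimage_set0 set0I !measure0 mule0 adde0.
rewrite area_annulus//.
have -> : `]a, b] `&` `]-oo, 0] = `]a, Num.min b 0]%classic.
  apply/seteqP; split => x /=; rewrite !in_itv/= le_min.
    by move=> [/andP[-> ->] ->].
  by move=> /and3P[-> -> ->].
rewrite !lebesgue_measure_itv/= !lte_fin ab -EFinM mulrA mulVf ?gt_eqF
  ?pi_gt0// mul1r.
case: ifPn => h; rewrite -?EFinB -?EFinD; congr EFin; move: h.
  by rewrite lt_min => /andP[_ a0]; rewrite (max_r (ltW a0)) maxEle minEle;
    case: ifP; lra.
rewrite lt_min ab/= -leNgt => a0.
by rewrite (max_l a0) max_l; lra.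
Qed.

(** This replaces polar coordinates: the left side is an integral against the image of plane measure
    under [sqn], which on [0, 1[ is [pi] times Lebesgue measure. *)
Lemma integral_radial (g : R -> \bar R) : measurable_fun [set: R] g ->
  (forall t, 0 <= g t)%E ->
  (\int[mu \x mu]_(p in sqn @^-1` `[0%R, 1%R[) g (sqn p)
   = pi%:E * \int[mu]_(t in `[0%R, 1%R[) g t)%E.
Proof.
move=> mg g0.
have m01 : measurable (`[0%R, 1%R[ : set (measurableTypeR R)) by [].
have mg' : measurable_fun (`[0%R, 1%R[ : set (measurableTypeR R)) g.
  exact: measurable_funTS.
rewrite -(@ge0_integral_pushforward _ _ _ _ _ _ measurable_sqn (mu \x mu)%E)//.
pose k : {nonneg R} := NngNum (@pi_ge0 R).
rewrite -[X in (X * _)%E]/(k%:num%:E) -ge0_integral_mscale//.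
apply: (@eq_measure_integral _ (measurableTypeR R) _ _ (mscale k mu)
  (measure_function_pushforward__canonical__measure_function_Measure
    (mu \x mu)%E measurable_sqn)) => A mA A01.
transitivity (pi%:E * radial A)%E; last first.
  by congr (_ * _)%E; apply/esym/radial_lebesgue.
rewrite radialE.
(* Inside [0, 1[ the summand added on the negative half line sees at most the point 0. *)
have -> : mu (A `&` `]-oo, 0]) = 0%E.
  apply: (@subset_measure0 _ _ _ mu _ [set 0]) => //;
    last exact: lebesgue_measure_set1.
  - exact: measurableI.
  - move=> x [/A01]; rewrite /= !in_itv/= => /andP[x0 _] x0'.
    by apply/eqP; rewrite eq_le x0 x0'.
by rewrite adde0 muleA -EFinM mulfV ?gt_eqF ?pi_gt0// mul1e.
Qed.

Lemma integral_powR_itv01 (gamma : R) : -1 < gamma ->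
  (\int[mu]_(t in `[0%R, 1%R[) ((1 - t) `^ gamma)%:E = ((gamma + 1)^-1)%:E)%E.
Proof.
move=> g1; have g1' : 0 < gamma + 1 by lra.
(* For negative [gamma] the integrand is singular at 1, so [0, 1[ is exhausted by compact intervals
   and monotone convergence is applied. The shift by 2 keeps even the first interval
   nondegenerate. *)
pose F n : set R := `[0, 1 - n.+2%:R^-1]%classic.
have nF n : n.+2%:R^-1 < 1 :> R by rewrite invf_lt1 ?ltr1n.
have -> : `[0, 1[%classic = \bigcup_n F n.
  apply/seteqP; split => t /=; last first.
    move=> [n _]; rewrite /F /= !in_itv/= => /andP[-> h].
    by rewrite (le_lt_trans h)// gtrBl invr_gt0.
  rewrite in_itv/= => /andP[t0 t1].
  have [n hn] := ltr_add_invr t1.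
  exists n => //; rewrite /F /= in_itv/= t0/=.
  by rewrite lerBrDr (le_trans _ (ltW hn))// lerD2l lef_pV2 ?posrE// ler_nat.
have mp : measurable_fun [set: R] (fun t : R => (1 - t) `^ gamma).
  apply: (measurableT_comp (measurable_powR gamma)).
  by apply: measurable_funB.
pose P (t : R) := - (1 - t) `^ (gamma + 1) / (gamma + 1).
have dP (t : R) : t < 1 -> is_derive t 1 P ((1 - t) `^ gamma).
  move=> t1; have t1' : 0 < 1 - t by rewrite subr_gt0.
  have d1 := is_deriveB (is_derive_cst (1 : R) t 1) (is_derive_id t 1).
  have d2 := is_deriveN (@is_derive1_comp _ _ (cst 1 - id) t _ _
    (is_derive1_powR (gamma + 1) t1') d1).
  apply: (is_derive1_congr (is_deriveM d2 (is_derive_cst (gamma + 1)^-1 t 1))).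
    by [].
  by rewrite /GRing.scale /= /cst addrK; field; rewrite gt_eqF.
have cpow (t : R) : t < 1 -> {for t, continuous (fun t : R => (1 - t) `^ gamma)}.
  move=> t1; have t1' : 0 < 1 - t by rewrite subr_gt0.
  have d1 := is_deriveB (is_derive_cst (1 : R) t 1) (is_derive_id t 1).
  have [d2 _] := @is_derive1_comp _ _ (cst 1 - id) t _ _ (is_derive1_powR gamma
    t1') d1.
  by apply: differentiable_continuous; apply/derivable1_diffP.
have IF n : (\int[mu]_(t in F n) ((1 - t) `^ gamma)%:E =
    ((1 - n.+2%:R^-1 `^ (gamma + 1)) / (gamma + 1))%:E)%E.
  have h1 t : t \in `[0, 1 - n.+2%:R^-1] -> t < 1.
    by rewrite in_itv/= => /andP[_ h]; rewrite (le_lt_trans h)// gtrBl invr_gt0.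
  have cP (t : R) : t < 1 -> {for t, continuous P}.
    by move=> /dP[d _]; apply: differentiable_continuous; apply/derivable1_diffP.
  rewrite /F (@continuous_FTC2 _ _ P) ?subr_gt0//.
  - rewrite -EFinB /P subr0 powR1 opprB addrCA subrr addr0; congr EFin.
    by field; rewrite gt_eqF.
  - by apply: continuous_in_subspaceT => t; rewrite inE => /h1/cpow.
  - split.
    + by move=> t /subset_itv_oo_cc/h1/dP[].
    + by apply: cvg_at_right_filter; apply: cP.
    + by apply: cvg_at_left_filter; apply: cP; rewrite gtrBl invr_gt0.
  - by move=> t /subset_itv_oo_cc/h1/dP[_ <-]; rewrite derive1E.
have cI : (\int[mu]_(t in F n) ((1 - t) `^ gamma)%:E @[n --> \oo] -->
    \int[mu]_(t in \bigcup_n F n) ((1 - t) `^ gamma)%:E)%E.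
  apply: ge0_nondecreasing_set_cvg_integral => //.
  - apply/nondecreasing_seqP => n; apply/subsetPset => t.
    rewrite /F /= !in_itv/= => /andP[-> h] /=; rewrite (le_trans h)//.
    by rewrite lerD2l lerN2 lef_pV2 ?posrE// ler_nat.
  - by move=> n; exact: measurable_itv.
  - by move=> n; apply/measurable_EFinP; exact: measurable_funTS.
  - by move=> n t _; rewrite lee_fin powR_ge0.
apply/esym/(cvg_unique _ _ cI); first exact: ereal_hausdorff.
rewrite /= (eq_cvg _ _ IF).
apply: cvg_EFin; first exact: nearW.
rewrite -[X in _ --> X]mul1r; apply: cvgM; last exact: cvg_cst.
rewrite -[X in _ --> X]subr0; apply: cvgB; first exact: cvg_cst.
have h : n.+2%:R^-1 @[n --> \oo] --> (0 : R)^'+.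
  move=> A [e e0 eA]; suff : \forall n \near \oo, A (n.+2%:R^-1) by [].
  near=> n; apply: eA => /=; last by rewrite invr_gt0.
  rewrite sub0r normrN ger0_norm ?invr_ge0//.
  rewrite (@lt_trans _ _ n.+1%:R^-1)//.
    by rewrite ltf_pV2 ?posrE// ltr_nat.
  by near: n; exact: near_infty_natSinv_lt (PosNum e0).
exact: (cvg_comp _ _ h (powR_cvg0 g1')).
Unshelve. all: by end_near. Qed.

End RadialIntegration.

(** * The weight as a probability density and as the universal majorant *)

Section WeightedIntegrals.
Context {R : realType} (gamma : R).
Hypothesis gamma_gtN1 : -1 < gamma.
Notation mu := (@lebesgue_measure R).
Local Notation T := (measurableTypeR R * measurableTypeR R)%type.
Notation lebesgue2 := (@lebesgue2 R).
Implicit Types (f g : R[i] -> R[i]) (z w b c : R[i]).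

Lemma pdisc_sqn : @pdisc R = sqn @^-1` `[0, 1[.
Proof.
apply/seteqP; split => p; rewrite /= in_itv/= /sqn.
  by rewrite pdiscE => ->; rewrite addr_ge0 ?sqr_ge0.
by move=> /andP[_]; rewrite pdiscE.
Qed.

Lemma densE (p : T) : dens gamma (cplx p) = (gamma + 1) / pi * (1 - sqn p) `^ gamma.
Proof. by rewrite /dens normc_sqr /sqn /=; ring. Qed.

Lemma measurable_dens : measurable_fun [set: T] (fun p => dens gamma (cplx p)).
Proof.
under eq_fun do rewrite densE.
apply: measurable_funM; first exact: measurable_cst.
apply: (measurableT_comp (measurable_powR gamma)).
by apply: measurable_funB => //; exact: measurable_sqn.
Qed.

Lemma dens_ge0 z : 0 <= dens gamma z.
Proof.
by rewrite /dens divr_ge0 ?pi_ge0// mulr_ge0 ?powR_ge0// -lerBlDr sub0r ltW.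
Qed.

Lemma integral_dens :
  (\int[mu \x mu]_(p in @pdisc R) (dens gamma (cplx p))%:E = 1)%E.
Proof.
have k0 : 0 <= (gamma + 1) / pi.
  by rewrite divr_ge0 ?pi_ge0// -lerBlDr sub0r ltW.
have mp : measurable_fun [set: R] (fun t : R => (1 - t) `^ gamma).
  by apply: (measurableT_comp (measurable_powR gamma)); apply: measurable_funB.
under eq_integral do rewrite densE EFinM.
rewrite ge0_integralZl//; last 3 first.
- exact: measurable_pdisc.
- apply/measurable_EFinP; apply: measurable_funTS.
  exact: (measurableT_comp mp measurable_sqn).
- by move=> p _; rewrite lee_fin powR_ge0.
rewrite pdisc_sqn (integral_radial (g := fun t => ((1 - t) `^ gamma)%:E));
  last 2 first.
- exact/measurable_EFinP.
- by move=> t; rewrite lee_fin powR_ge0.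
rewrite integral_powR_itv01// -!EFinM; congr EFin.
have p0 := @pi_gt0 R; move: pi p0 => q q0; field.
by rewrite !gt_eqF// -ltrBlDr sub0r.
Qed.

Lemma integrable_dens : lebesgue2.-integrable (@pdisc R) (fun p =>
  (dens gamma (cplx p))%:E).
Proof.
apply/integrableP; split.
  by apply/measurable_EFinP; apply: measurable_funTS; exact: measurable_dens.
under eq_integral do rewrite gee0_abs ?lee_fin ?dens_ge0//.
by rewrite [X in (X < _)%E]integral_dens ltry.
Qed.

(** The majorant is the weight and not a constant, so that derivatives which blow up at the circle
    like (1 - |w|^2)^gamma are covered. *)
Lemma integrable_le_dens (h : T -> R) (K : R) : measurable_fun [set: T] h ->
  (forall p, pdisc p -> `|h p| <= K * dens gamma (cplx p)) ->
  lebesgue2.-integrable (@pdisc R) (EFin \o h).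
Proof.
move=> mh hK; have := integrableZl (@measurable_pdisc R) K integrable_dens.
apply: le_integrable => //; first exact: measurable_pdisc.
  by apply/measurable_EFinP; exact: measurable_funTS.
move=> p /hK hp /=; rewrite lee_fin (le_trans hp)//.
by rewrite ler_norm.
Qed.

Definition cbounded f := exists M : R, forall w, disc w -> normc (f w) <= M.

(** A class closed under the ring operations and conjugation, containing the kernels with parameter
    in the disc, whose members are integrable against the weight. *)
Definition cadmissible f := cmeasurable (f \o @cplx R) /\ cbounded f.

Lemma cadmissible_cst c : cadmissible (fun=> c).
Proof. by split; [exact: cmeasurable_cst|exists (normc c)]. Qed.

Lemma cadmissible_id : cadmissible id.
Proof. by split; [exact: cmeasurable_cplx|exists 1 => w /ltW]. Qed.

Lemma cadmissibleD f g : cadmissible f -> cadmissible g ->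
  cadmissible (fun w => f w + g w).
Proof.
move=> [mf [M fM]] [mg [N gN]]; split; first exact: (cmeasurableD mf mg).
exists (M + N) => w dw; apply: le_trans (normcD _ _) _.
by rewrite lerD ?fM ?gN.
Qed.

Lemma cadmissibleM f g : cadmissible f -> cadmissible g ->
  cadmissible (fun w => f w * g w).
Proof.
move=> [mf [M fM]] [mg [N gN]]; split; first exact: (cmeasurableM mf mg).
by exists (M * N) => w dw; rewrite normcM ler_pM ?normc_ge0 ?fM ?gN.
Qed.

Lemma cadmissibleN f : cadmissible f -> cadmissible (fun w => - f w).
Proof.
move=> [mf [M fM]]; split; first exact: (cmeasurableN mf).
by exists M => w dw; rewrite normcN fM.
Qed.

Lemma cadmissibleJ f : cadmissible f -> cadmissible (fun w => (f w)^*).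
Proof.
move=> [mf [M fM]]; split; first exact: (cmeasurableJ mf).
by exists M => w dw; rewrite normcJ fM.
Qed.

(** The modulus of the base lies between 1 - rho and 2. The bound depends on [b] through [rho] only,
    as domination uniform in a parameter requires. *)
Lemma normc_rpow_1sub_le (rho r : R) b w : rho < 1 -> normc b <= rho ->
  disc w -> normc (rpow (1 - b * w) r) <= expR (`|r| * (`|ln (1 - rho)| + `|ln 2|)).
Proof.
move=> rho1 brho dw; have b1 : normc b < 1 by exact: le_lt_trans brho rho1.
have w1 : normc w <= 1 by exact: ltW.
rewrite normc_rpow ?Re_1sub_gt0//; apply: powR_le_bound; first by rewrite subr_gt0.
rewrite normc_1sub_le// ?(ltW b1)// andbT.
apply: le_trans (Re_1sub brho (ltW dw)) _.
by rewrite (le_trans (ler_norm _))// abs_Re_le.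
Qed.

Lemma cadmissible_rpow b (r : R) : normc b < 1 ->
  cadmissible (fun w => rpow (1 - b * w) r).
Proof.
move=> b1; split.
  apply: cmeasurable_rpow; apply: cmeasurableD; first exact: cmeasurable_cst.
  apply: cmeasurableN; apply: cmeasurableM; first exact: cmeasurable_cst.
  exact: cmeasurable_cplx.
by eexists => w dw; exact: (normc_rpow_1sub_le r b1 (lexx _) dw).
Qed.

Lemma integrable_Re f : cadmissible f -> lebesgue2.-integrable (@pdisc R)
  (EFin \o (fun p => Re (f (cplx p)) * dens gamma (cplx p))).
Proof.
move=> [[mf _] [M fM]]; apply: (@integrable_le_dens _ M).
  by apply: measurable_funM => //; exact: measurable_dens.
move=> p dp; rewrite normrM (ger0_norm (dens_ge0 _)) ler_wpM2r ?dens_ge0//.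
exact: le_trans (abs_Re_le _) (fM _ dp).
Qed.

Lemma integrable_Im f : cadmissible f -> lebesgue2.-integrable (@pdisc R)
  (EFin \o (fun p => Im (f (cplx p)) * dens gamma (cplx p))).
Proof.
move=> [[_ mf] [M fM]]; apply: (@integrable_le_dens _ M).
  by apply: measurable_funM => //; exact: measurable_dens.
move=> p dp; rewrite normrM (ger0_norm (dens_ge0 _)) ler_wpM2r ?dens_ge0//.
exact: le_trans (abs_Im_le _) (fM _ dp).
Qed.

Lemma eq_cintegral f g : (forall w, disc w -> f w = g w) ->
  cintegral gamma f = cintegral gamma g.
Proof.
by move=> fg; congr (_ +i* _); apply: eq_Rintegral => p; rewrite inE => /fg ->.
Qed.

Lemma cintegralZl c f : cadmissible f ->
  cintegral gamma (fun w => c * f w) = c * cintegral gamma f.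
Proof.
move=> af; have iRe := integrable_Re af; have iIm := integrable_Im af.
have mD := @measurable_pdisc R.
have iZRe k := integrableZl mD k iRe; have iZIm k := integrableZl mD k iIm.
apply: complexP; rewrite !reimE /cintegral /=.
  rewrite -!RintegralZl// -RintegralB//; last 2 first.
  - exact: (iZRe (Re c)).
  - exact: (iZIm (Im c)).
  by apply: eq_Rintegral => p _; rewrite reimE; ring.
rewrite -!RintegralZl// -RintegralD//; last 2 first.
- exact: (iZIm (Re c)).
- exact: (iZRe (Im c)).
by apply: eq_Rintegral => p _; rewrite reimE; ring.
Qed.

Lemma cintegralJ f : cadmissible f ->
  cintegral gamma (fun w => (f w)^*) = (cintegral gamma f)^*.
Proof.
move=> af; have iIm := integrable_Im af.
apply: complexP; rewrite !reimE /cintegral /=.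
  by apply: eq_Rintegral => p _; rewrite reimE.
rewrite -mulN1r -RintegralZl//; last exact: measurable_pdisc.
by apply: eq_Rintegral => p _; rewrite reimE; ring.
Qed.

Lemma cintegral1 : cintegral gamma (fun=> 1) = 1.
Proof.
apply: complexP; rewrite /cintegral /=.
  under eq_Rintegral do rewrite mul1r.
  by rewrite /Rintegral [X in fine X]integral_dens.
under eq_Rintegral do rewrite mul0r.
by rewrite /Rintegral integral0.
Qed.

End WeightedIntegrals.

(** * Orthogonality to the kernel of functions with the factor w - xi *)

Section KernelOrthogonality.
Context {R : realType} (gamma : R).
Hypothesis gamma_gtN1 : -1 < gamma.
Notation mu := (@lebesgue_measure R).
Local Notation T := (measurableTypeR R * measurableTypeR R)%type.
Notation lebesgue2 := (@lebesgue2 R).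
Implicit Types (f g : R[i] -> R[i]) (z w b c h : R[i]).

Lemma is_cderive_hpath (x y : R) : is_cderive (fun u => cplx (u, y)) x 1.
Proof. by split; [exact: is_derive_id|exact: is_derive_cst]. Qed.

Lemma is_cderive_vpath (x y : R) : is_cderive (fun u => cplx (x, u)) y 'i%C.
Proof. by split; [exact: is_derive_cst|exact: is_derive_id]. Qed.

(* The divergence theorem for a function vanishing on the circle; [E1] and [E2]
   are the partial derivatives of [E], so [E1 + 'i * E2] is twice its
   derivative with respect to the conjugate variable. *)
Lemma cintegral_dbar0 (E E1 E2 f : R[i] -> R[i]) (K s : R) : 0 < s ->
  cmeasurable (E1 \o @cplx R) -> cmeasurable (E2 \o @cplx R) ->
  (forall w, disc w -> normc (E1 w) <= K * dens gamma w) ->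
  (forall w, disc w -> normc (E2 w) <= K * dens gamma w) ->
  (forall w, disc w -> normc (E w) <= K * (1 - normc w ^+ 2) `^ s) ->
  (forall (x y : R), disc (cplx (x, y)) ->
    is_cderive (fun u => E (cplx (u, y))) x (E1 (cplx (x, y))) /\
    exists d, is_cderive (fun u => E1 (cplx (u, y))) x d) ->
  (forall (x y : R), disc (cplx (x, y)) ->
    is_cderive (fun u => E (cplx (x, u))) y (E2 (cplx (x, y))) /\
    exists d, is_cderive (fun u => E2 (cplx (x, u))) y d) ->
  (forall w, disc w -> E1 w + 'i%C * E2 w = f w * (dens gamma w)%:C) ->
  cintegral gamma f = 0.
Proof.
move=> s0 [mR1 mI1] [mR2 mI2] b1 b2 b0 d1 d2 Ef.
have iR1 : lebesgue2.-integrable (@pdisc R) (EFin \o (fun p => Re (E1 (cplx p)))).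
  by apply: (integrable_le_dens gamma_gtN1 mR1) => p dp;
    exact: le_trans (abs_Re_le _) (b1 _ dp).
have iI1 : lebesgue2.-integrable (@pdisc R) (EFin \o (fun p => Im (E1 (cplx p)))).
  by apply: (integrable_le_dens gamma_gtN1 mI1) => p dp;
    exact: le_trans (abs_Im_le _) (b1 _ dp).
have iR2 : lebesgue2.-integrable (@pdisc R) (EFin \o (fun p => Re (E2 (cplx p)))).
  by apply: (integrable_le_dens gamma_gtN1 mR2) => p dp;
    exact: le_trans (abs_Re_le _) (b2 _ dp).
have iI2 : lebesgue2.-integrable (@pdisc R) (EFin \o (fun p => Im (E2 (cplx p)))).
  by apply: (integrable_le_dens gamma_gtN1 mI2) => p dp;
    exact: le_trans (abs_Im_le _) (b2 _ dp).
have bR (p : T) : pdisc p -> `|Re (E (cplx p))| <=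
  K * (1 - (p.1 ^+ 2 + p.2 ^+ 2)) `^ s.
  by move=> dp; apply: le_trans (abs_Re_le _) _; have := b0 _ dp; rewrite normc_sqr.
have bI (p : T) : pdisc p -> `|Im (E (cplx p))| <=
  K * (1 - (p.1 ^+ 2 + p.2 ^+ 2)) `^ s.
  by move=> dp; apply: le_trans (abs_Im_le _) _; have := b0 _ dp; rewrite normc_sqr.
(* Here and below, the second derivative along a slice serves to make the first one continuous
   there. *)
have R1 : Rintegral lebesgue2 (@pdisc R) (fun p => Re (E1 (cplx p))) = 0.
  apply: (Rintegral_partial1_disc0 s0 iR1 bR) => x y /d1[[dE _] [d dE1]] //.
  by case: (is_cderive_continuous dE1).
have I1 : Rintegral lebesgue2 (@pdisc R) (fun p => Im (E1 (cplx p))) = 0.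
  apply: (Rintegral_partial1_disc0 s0 iI1 bI) => x y /d1[[_ dE] [d dE1]] //.
  by case: (is_cderive_continuous dE1).
have R2 : Rintegral lebesgue2 (@pdisc R) (fun p => Re (E2 (cplx p))) = 0.
  apply: (Rintegral_partial2_disc0 s0 iR2 bR) => x y /d2[[dE _] [d dE1]] //.
  by case: (is_cderive_continuous dE1).
have I2 : Rintegral lebesgue2 (@pdisc R) (fun p => Im (E2 (cplx p))) = 0.
  apply: (Rintegral_partial2_disc0 s0 iI2 bI) => x y /d2[[_ dE] [d dE1]] //.
  by case: (is_cderive_continuous dE1).
have mD := @measurable_pdisc R.
apply: complexP; rewrite /cintegral /=.
  rewrite -[RHS](subrr 0) -{1}R1 -I2 -RintegralB//.
  apply: eq_Rintegral => p; rewrite inE => /Ef /(congr1 Re).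
  by rewrite !reimE /= !mulr0 subr0 => <-; ring.
rewrite -[RHS](addr0 0) -{1}I1 -R2 -RintegralD//.
apply: eq_Rintegral => p; rewrite inE => /Ef /(congr1 Im).
by rewrite !reimE /= !mulr0 add0r => <-; ring.
Qed.

Variables (b xi : R[i]) (r : R).
Hypotheses (b1 : normc b < 1) (xi1 : normc xi < 1).

Let G (t : R) w := rpow (1 - b * w) t.
Let B (t : R) w := rpow (1 - xi^* * w) t.
Let W (t : R) w := rpow (1 - w * w^*) t.
(** Chosen so that -2 k (gamma + 1) is the constant (gamma + 1) / pi of the weight; [F_sum] then
    holds with no leftover factor. *)
Let k : R[i] := (- (2 * pi)^-1)%:C.
Let E w := k * (G r w * W (gamma + 1) w * (B (- (gamma + 1)) w)^*).
(** The derivative of [E] in the direction [h], divided by (1 - |w|^2)^gamma. The three terms come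
    from differentiating [G], [W] and [B]. Taking out the possibly singular power leaves a bounded
    function. *)
Let F h w := k *
  ((- r%:C * b * h) * (G (r - 1) w * (1 - w * w^*) * (B (- (gamma + 1)) w)^*)
   - (gamma + 1)%:C * (G r w * (h * w^* + h^* * w) * (B (- (gamma + 1)) w)^*)
   + ((gamma + 1)%:C * xi * h^*) * (G r w * (1 - w * w^*) * (B (- (gamma + 1) -
     1) w)^*)).

Let weight_gt0 w : disc w -> 0 < Re (1 - w * w^*).
Proof.
move=> dw; rewrite mulJ_normc ReD ReN /= subr_gt0 expr_lt1//; exact: normc_ge0.
Qed.

Let weight_real w : 1 - w * w^* = (1 - normc w ^+ 2)%:C.
Proof. by rewrite mulJ_normc rmorphB. Qed.

Let W_S w : disc w -> W (gamma + 1) w = (1 - w * w^*) * W gamma w.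
Proof. by move=> dw; rewrite /W rpowD rpow1 ?weight_gt0// mulrC. Qed.

Let W_dens w : disc w -> (dens gamma w)%:C = ((gamma + 1) / pi)%:C * W gamma w.
Proof.
move=> dw; rewrite /W weight_real rpow_real; last first.
  by have := weight_gt0 dw; rewrite weight_real.
by rewrite -rmorphM /dens; congr (_%:C); ring.
Qed.

Let B_S w : disc w -> B (- (gamma + 1)) w = (1 - xi^* * w) * B (- (gamma + 1) -
  1) w.
Proof.
move=> dw; rewrite /B -{2}[1 - _]rpow1 ?Re_1sub_gt0 ?normcJ// ?ltW//.
by rewrite -rpowD; congr rpow; ring.
Qed.

Let conji : ('i%C : R[i])^* = - 'i%C.
Proof. by apply: complexP; rewrite !reimE /= ?oppr0. Qed.

(** Adding the directions 1 and i, the latter times i, cancels the terms linear in h, as 1 + i i =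
    0, and doubles those in the conjugate of h. With v the conjugate of w, what remains is - w (1 -
    xi v) + xi (1 - w v) = xi - w. *)
Let F_sum w : disc w -> F 1 w * W gamma w + 'i%C * (F 'i%C w * W gamma w) =
  (w - xi) * (G r w * (B (- (gamma + 2)) w)^*) * (dens gamma w)%:C.
Proof.
move=> dw; rewrite W_dens// /F.
have e : - (gamma + 1) - 1 = - (gamma + 2) by ring.
have -> : (B (- (gamma + 1)) w)^* = (1 - xi * w^*) * (B (- (gamma + 2)) w)^*.
  by rewrite B_S// rmorphM rmorphB rmorph1 rmorphM /= conjCK e.
rewrite e.
have -> : ((gamma + 1) / pi)%:C = - (2 * k * (gamma + 1)%:C).
  have -> : 2 = (2 : R)%:C by rewrite rmorph_nat.
  rewrite /k -!rmorphM -rmorphN; congr (_%:C).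
  by have p0 := @pi_gt0 R; move: pi p0 => q q0; field; rewrite gt_eqF.
rewrite rmorph1 conji.
have i2 : 'i%C * 'i%C = -1 :> R[i] by apply: complexP; rewrite !reimE /=; ring.
(* After generalization the identity is polynomial, with the conjugate of [w] as an independent
   variable and i^2 = -1 as the only relation. *)
move: (G r w) (G (r - 1) w) (B (- (gamma + 2)) w)^* (W gamma w) i2.
move: w^* ('i%C : R[i]) k (gamma + 1)%:C r%:C => wc j k' g r' Gr Gr1 Bw Ww i2.
by ring: i2.
Qed.

Let F_path (wp : R -> R[i]) (t : R) h : disc (wp t) -> is_cderive wp t h ->
  is_cderive (fun u => E (wp u)) t (F h (wp t) * W gamma (wp t)).
Proof.
move=> dw dwp; have w1 : normc (wp t) <= 1 by exact: ltW.
have dJ := is_cderiveJ dwp.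
have c1 := is_cderive_cst (1 : R[i]) t.
have xi1' : normc xi^* < 1 by rewrite normcJ.
have dG := is_cderive_rpow r (Re_1sub_gt0 b1 w1)
  (is_cderiveD c1 (is_cderiveN (is_cderiveM (is_cderive_cst b t) dwp))).
have dW := is_cderive_rpow (gamma + 1) (weight_gt0 dw)
  (is_cderiveD c1 (is_cderiveN (is_cderiveM dwp dJ))).
have dB := is_cderive_rpow (- (gamma + 1)) (Re_1sub_gt0 xi1' w1)
  (is_cderiveD c1 (is_cderiveN (is_cderiveM (is_cderive_cst xi^* t) dwp))).
apply: (is_cderive_eq (is_cderiveM (is_cderive_cst k t)
  (is_cderiveM (is_cderiveM dG dW) (is_cderiveJ dB)))).
rewrite addrK -/(W gamma (wp t)) -/(W (gamma + 1) (wp t)) W_S// /F /G /B.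
rewrite !(rmorphM, rmorphD, rmorphN) /= !conjCK.
have conjC (x : R) : (x%:C)^* = x%:C by apply: complexP; rewrite !reimE /= ?oppr0.
by rewrite !conjC rmorph0; ring.
Qed.

Let F_path_derivable (wp : R -> R[i]) (t : R) h h' : disc (wp t) ->
  is_cderive wp t h' ->
  exists d, is_cderive (fun u => F h (wp u) * W gamma (wp u)) t d.
Proof.
move=> dw dwp; have w1 : normc (wp t) <= 1 by exact: ltW.
have dJ := is_cderiveJ dwp.
have cc c := is_cderive_cst (c : R[i]) t.
have xi1' : normc xi^* < 1 by rewrite normcJ.
have dw1 := is_cderiveD (cc 1) (is_cderiveN (is_cderiveM dwp dJ)).
have dG e := is_cderive_rpow e (Re_1sub_gt0 b1 w1)
  (is_cderiveD (cc 1) (is_cderiveN (is_cderiveM (cc b) dwp))).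
have dW := is_cderive_rpow gamma (weight_gt0 dw) dw1.
have dB e := is_cderiveJ (is_cderive_rpow e (Re_1sub_gt0 xi1' w1)
  (is_cderiveD (cc 1) (is_cderiveN (is_cderiveM (cc xi^*) dwp)))).
eexists; apply: is_cderiveM (dW); apply: is_cderiveM (cc _) _.
apply: is_cderiveD; first apply: is_cderiveD.
- apply: is_cderiveM (cc _) _; exact: is_cderiveM (is_cderiveM (dG _) dw1) (dB _).
- apply: is_cderiveN; apply: is_cderiveM (cc _) _.
  apply: is_cderiveM (dB _); apply: is_cderiveM (dG _) _.
  exact: is_cderiveD (is_cderiveM (cc _) dJ) (is_cderiveM (cc _) dwp).
- apply: is_cderiveM (cc _) _; exact: is_cderiveM (is_cderiveM (dG _) dw1) (dB _).
Qed.

Let admF h : cadmissible (F h).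
Proof.
have aG e : cadmissible (G e) by exact: cadmissible_rpow.
have aB e : cadmissible (fun w => (B e w)^*).
  by apply: cadmissibleJ; apply: cadmissible_rpow; rewrite normcJ.
have cc c := @cadmissible_cst R c.
have ii := @cadmissible_id R.
have iJ := cadmissibleJ ii.
have ad1 := cadmissibleD (cc 1) (cadmissibleN (cadmissibleM ii iJ)).
apply: cadmissibleM (cc _) _; apply: cadmissibleD; first apply: cadmissibleD.
- apply: cadmissibleM (cc _) _; exact: cadmissibleM (cadmissibleM (aG _) ad1)
  (aB _).
- apply: cadmissibleN; apply: cadmissibleM (cc _) _.
  apply: cadmissibleM (aB _); apply: cadmissibleM (aG _) _.
  exact: cadmissibleD (cadmissibleM (cc _) iJ) (cadmissibleM (cc _) ii).
- apply: cadmissibleM (cc _) _; exact: cadmissibleM (cadmissibleM (aG _) ad1)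
  (aB _).
Qed.

Let measW : cmeasurable (W gamma \o @cplx R).
Proof.
apply: cmeasurable_rpow; apply: cmeasurableD; first exact: cmeasurable_cst.
apply: cmeasurableN; apply: cmeasurableM; first exact: cmeasurable_cplx.
by apply: cmeasurableJ; exact: cmeasurable_cplx.
Qed.

Let normc_W e w : disc w -> normc (W e w) = (1 - normc w ^+ 2) `^ e.
Proof.
move=> dw; have := weight_gt0 dw; rewrite weight_real => h.
by rewrite /W weight_real rpow_real// normc_real ger0_norm ?powR_ge0.
Qed.

Lemma kernel_orthogonal : cintegral gamma (fun w =>
  (w - xi) * (rpow (1 - b * w) r * (rpow (1 - xi^* * w) (- (gamma + 2)))^*)) = 0.
Proof.
have g1 : 0 < gamma + 1 by rewrite -ltrBlDr sub0r.
have [mF1 [M1 bM1]] := admF 1; have [mF2 [M2 bM2]] := admF 'i%C.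
have [M bM] : exists M, forall w, disc w -> normc (E w) <=
  M * (1 - normc w ^+ 2) `^ (gamma + 1).
  have [_ [M0 bM0]] : cadmissible (fun w => k * (G r w * (B (- (gamma + 1)) w)^*)).
    apply: cadmissibleM; first exact: cadmissible_cst.
    apply: cadmissibleM; first exact: cadmissible_rpow.
    by apply: cadmissibleJ; apply: cadmissible_rpow; rewrite normcJ.
  exists M0 => w dw; rewrite -normc_W//.
  have -> : E w = k * (G r w * (B (- (gamma + 1)) w)^*) * W (gamma + 1) w.
    by rewrite /E; ring.
  by rewrite normcM ler_wpM2r ?normc_ge0// bM0.
(* Dividing by the constant of [dens] turns a bound by (1 - |w|^2)^gamma into one by [dens]. The
   maximum with [M] provides the single constant shared by [E] and its derivatives. *)
pose K0 := Num.max M1 M2 / ((gamma + 1) / pi).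
have bF h N : (forall w, disc w -> normc (F h w) <= N) -> N <= Num.max M1 M2 ->
    forall w, disc w -> normc (F h w * W gamma w) <= Num.max M K0 * dens gamma w.
  move=> hN NM w dw; apply: (@le_trans _ _ (K0 * dens gamma w)); last first.
    by rewrite ler_wpM2r ?dens_ge0// le_max lexx orbT.
  have -> : K0 * dens gamma w = Num.max M1 M2 * (1 - normc w ^+ 2) `^ gamma.
    have p0 := @pi_gt0 R; rewrite /K0 /dens; move: pi p0 => q q0; field.
    by rewrite !gt_eqF.
  by rewrite normcM normc_W// ler_wpM2r ?powR_ge0// (le_trans (hN _ dw)).
apply: (@cintegral_dbar0 E (fun w => F 1 w * W gamma w) (fun w =>
  F 'i%C w * W gamma w) _ (Num.max M K0) (gamma + 1)).
- exact: g1.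
- exact: (cmeasurableM mF1 measW).
- exact: (cmeasurableM mF2 measW).
- by apply: (bF _ _ bM1); rewrite le_max lexx.
- by apply: (bF _ _ bM2); rewrite le_max lexx orbT.
- move=> w dw; apply: (le_trans (bM _ dw)); rewrite ler_wpM2r ?powR_ge0//.
  by rewrite le_max lexx.
- move=> x y dw; split; first exact: (@F_path (fun u =>
  cplx (u, y)) x 1 dw (is_cderive_hpath x y)).
  exact: (@F_path_derivable (fun u => cplx (u, y)) x 1 1 dw (is_cderive_hpath x y)).
- move=> x y dw; split; first exact: (@F_path (fun u =>
  cplx (x, u)) y 'i%C dw (is_cderive_vpath x y)).
  exact: (@F_path_derivable (fun u => cplx (x, u)) y 'i%C 'i%C dw
    (is_cderive_vpath x y)).
- by move=> w dw; rewrite F_sum.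
Qed.

End KernelOrthogonality.

Lemma disc0 (R : realType) : disc (0 : R[i]).
Proof.
change (normc (0 : R[i]) < 1).
by rewrite ComplexField.Normc.normc0 ltr01.
Qed.

(** * The reproducing property for kernels *)

Section Reproducing.
Context {R : realType} (gamma : R).
Hypothesis gamma_gtN1 : -1 < gamma.
Notation mu := (@lebesgue_measure R).
Local Notation T := (measurableTypeR R * measurableTypeR R)%type.
Notation lebesgue2 := (@lebesgue2 R).
Implicit Types (z w b c h a xi : R[i]).

(** Differentiation under the integral sign gives derivative 0, and the mean value theorem
    concludes. Since [rho] exceeds 1, the closed interval [0, 1] lies in the open one where the
    domination holds. *)
Lemma Rintegral_parameter_cst (g dg : R -> T -> R) (K rho : R) : 1 < rho ->
  0 <= K ->
  (forall t : R, `|t| < rho -> lebesgue2.-integrable (@pdisc R) (EFin \o g t)) ->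
  (forall (t : R) (p : T), `|t| < rho -> pdisc p ->
    is_derive t 1 (g ^~ p) (dg t p)) ->
  (forall (t : R) (p : T), `|t| < rho -> pdisc p -> `|dg t p| <=
    K * dens gamma (cplx p)) ->
  (forall t : R, `|t| < rho -> Rintegral lebesgue2 (@pdisc R) (dg t) = 0) ->
  Rintegral lebesgue2 (@pdisc R) (g 1) = Rintegral lebesgue2 (@pdisc R) (g 0).
Proof.
move=> rho1 K0 ig dgE bdg dg0.
pose Phi t := Rintegral lebesgue2 (@pdisc R) (g t).
have inI (t : R) : `]- rho, rho[%classic t -> `|t|
  < rho by rewrite /= in_itv/= -ltr_norml.
have iG : lebesgue2.-integrable (@pdisc R) (EFin \o (fun p =>
  K * dens gamma (cplx p))).
  exact: (integrableZl (@measurable_pdisc R) K (integrable_dens gamma_gtN1)).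
have G0 p : 0 <= K * dens gamma (cplx p) by rewrite mulr_ge0 ?dens_ge0.
have dgD (t : R) p : `|t| < rho -> pdisc p -> derivable (g ^~ p) t 1.
  by move=> /dgE/[apply]-[].
have bG (t : R) p : `]- rho, rho[%classic t -> pdisc p -> `|partial1of2 g t p|
  <= K * dens gamma (cplx p).
  move=> /inI tr dp; rewrite partial1of2E.
  by have [_ ->] := dgE _ _ tr dp; exact: bdg.
have dPhi (t : R) : `|t| < rho -> is_derive t 1 Phi 0.
  move=> tr; have tI : `]- rho, rho[%classic t by rewrite /= in_itv/= -ltr_norml.
  apply: DeriveDef.
    apply: (@derivable_under_integral _ _ _ (mu \x mu)%E g _ (@measurable_pdisc
      R) t _ _ tI _ _ _ G0 iG bG).
      by move=> u /inI; exact: ig.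
    by move=> u p /inI; exact: dgD.
  rewrite -derive1E.
  rewrite (@differentiation_under_integral _ _ _ (mu \x mu)%E g _
    (@measurable_pdisc R) t _ _ tI _ _ _ G0 iG bG); last 2 first.
  - by move=> u /inI; exact: ig.
  - by move=> u p /inI; exact: dgD.
  rewrite -(dg0 _ tr); apply: eq_Rintegral => p; rewrite inE => dp.
  by rewrite partial1of2E; have [_ ->] := dgE _ _ tr dp.
have [||c _] := @MVT _ Phi (fun=> 0) 0 1 ltr01.
- by move=> t; rewrite in_itv/= => /andP[t0 t1]; apply: dPhi;
  rewrite gtr0_norm// (lt_trans t1).
- apply: continuous_in_subspaceT => t; rewrite inE/= in_itv/= => /andP[t0 t1].
  apply: differentiable_continuous; apply/derivable1_diffP.
  by have [] := dPhi t _; rewrite // ger0_norm// (le_lt_trans t1).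
by rewrite mul0r => /eqP; rewrite subr_eq0 => /eqP.
Qed.

Let s := gamma + 2.

Definition kernel a w := rpow (1 - a^* * w) (- (gamma + 2)).

Lemma cintegral_parameter_cst (g dg : R -> R[i] -> R[i]) (K rho : R) : 1 < rho ->
  (forall t : R, `|t| < rho -> cadmissible (g t)) ->
  (forall (t : R) w, `|t| < rho -> disc w -> is_cderive (g ^~ w) t (dg t w)) ->
  (forall (t : R) w, `|t| < rho -> disc w -> normc (dg t w) <= K) ->
  (forall t : R, `|t| < rho -> cintegral gamma (dg t) = 0) ->
  cintegral gamma (g 1) = cintegral gamma (g 0).
Proof.
move=> rho1 ag dgE bdg dg0.
have K0 : 0 <= K.
  apply: le_trans (normc_ge0 (dg 0 0)) (bdg 0 0 _ _).
    by rewrite normr0 (lt_trans ltr01).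
  exact: disc0.
apply: complexP; rewrite /cintegral /=.
  apply: (@Rintegral_parameter_cst (fun t p =>
    Re (g t (cplx p)) * dens gamma (cplx p))
    (fun t p => Re (dg t (cplx p)) * dens gamma (cplx p)) K rho) => //.
  - by move=> t /ag /(integrable_Re gamma_gtN1).
  - move=> t p tr dp; have [d _] := dgE _ _ tr dp.
    apply: (is_derive1_congr (is_deriveM d (is_derive_cst (dens gamma (cplx p))
      t 1))).
      by [].
    by rewrite /GRing.scale /= /cst; ring.
  - move=> t p tr dp; rewrite normrM (ger0_norm (dens_ge0 gamma_gtN1 _)).
    by rewrite ler_wpM2r ?dens_ge0// (le_trans (abs_Re_le _))// bdg.
  - by move=> t /dg0 /(congr1 Re).
apply: (@Rintegral_parameter_cst (fun t p =>
  Im (g t (cplx p)) * dens gamma (cplx p))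
    (fun t p => Im (dg t (cplx p)) * dens gamma (cplx p)) K rho) => //.
- by move=> t /ag /(integrable_Im gamma_gtN1).
- move=> t p tr dp; have [_ d] := dgE _ _ tr dp.
  apply: (is_derive1_congr (is_deriveM d (is_derive_cst (dens gamma (cplx p)) t
    1))).
    by [].
  by rewrite /GRing.scale /= /cst; ring.
- move=> t p tr dp; rewrite normrM (ger0_norm (dens_ge0 gamma_gtN1 _)).
  by rewrite ler_wpM2r ?dens_ge0// (le_trans (abs_Im_le _))// bdg.
- by move=> t /dg0 /(congr1 Im).
Qed.

Lemma cadmissible_kernel a : disc a -> cadmissible (kernel a).
Proof. by move=> da; apply: cadmissible_rpow; rewrite normcJ. Qed.

(* The function [t |-> (1 - t conj(a) xi)^s (1 - t conj(a) w)^-s] has a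
   derivative divisible by [w - xi], so its integral against the kernel at [xi]
   does not depend on [t]. *)
Lemma cintegral_kernel_shift a xi : disc a -> disc xi ->
  rpow (1 - a^* * xi) s * cintegral gamma (fun w => kernel a w * (kernel xi w)^*)
  = cintegral gamma (fun w => (kernel xi w)^*).
Proof.
move=> da dxi; have xi1 : normc xi <= 1 by exact: ltW.
have aK := cadmissibleJ (cadmissible_kernel dxi).
have ca0 : 0 <= normc a := normc_ge0 a.
have ca1 : normc a < 1 := da.
(* This choice gives rho > 1 and rho |a| < 1 together: t may pass 1 while t conj(a) stays in a fixed
   disc of radius r0 < 1. *)
pose rho := 2 / (1 + normc a); pose r0 := rho * normc a.
have rho1 : 1 < rho by rewrite ltr_pdivlMr; lra.
have r01 : r0 < 1 by rewrite /r0 /rho mulrAC ltr_pdivrMr; lra.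
have nb (t : R) : `|t| < rho -> normc (t%:C * a^*) <= r0.
  by move=> tr; rewrite normcM normc_real normcJ ler_wpM2r// ltW.
have nb1 (t : R) : `|t| < rho -> normc (t%:C * a^*) < 1.
  by move=> /nb/le_lt_trans; apply.
pose g (t : R) w := rpow (1 - (t%:C * a^*) * xi) s * rpow (1 - (t%:C * a^*) *
  w) (- s) * (kernel xi w)^*.
pose C (t : R) := s%:C * a^* * rpow (1 - (t%:C * a^*) * xi) (s - 1).
pose dg (t : R) w := C t * ((w - xi) * (rpow (1 - (t%:C * a^*) * w) (- s - 1) *
  (kernel xi w)^*)).
have ag (t : R) : `|t| < rho -> cadmissible (g t).
  move=> tr; apply: cadmissibleM aK; apply: cadmissibleM;
    first exact: cadmissible_cst.
  by apply: cadmissible_rpow; exact: nb1.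
have dgE (t : R) w : `|t| < rho -> disc w -> is_cderive (g ^~ w) t (dg t w).
  move=> tr dw; have w1 : normc w <= 1 by exact: ltW.
  have lin z : is_cderive (fun u => 1 - (u%:C * a^*) * z) t (- (a^* * z)).
    apply: (is_cderive_eq (is_cderiveD (is_cderive_cst 1 t) (is_cderiveN
      (is_cderiveM (is_cderiveM (is_cderive_id t) (is_cderive_cst a^* t))
        (is_cderive_cst z t))))).
    by ring.
  have zx := Re_1sub_gt0 (nb1 _ tr) xi1; have zw := Re_1sub_gt0 (nb1 _ tr) w1.
  apply: (is_cderive_eq (is_cderiveM (is_cderiveM (is_cderive_rpow s zx (lin xi))
    (is_cderive_rpow (- s) zw (lin w))) (is_cderive_cst (kernel xi w)^* t))).
  (* Splitting one factor off each power exposes what the derivative has in common. With c =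
     conj(a), the rest is s c (w (1 - t c xi) - xi (1 - t c w)) = s c (w - xi). *)
  have e1 : rpow (1 - (t%:C * a^*) * xi) s =
    (1 - (t%:C * a^*) * xi) * rpow (1 - (t%:C * a^*) * xi) (s - 1).
    by rewrite -{2}[1 - _]rpow1// -rpowD; congr rpow; ring.
  have e2 : rpow (1 - (t%:C * a^*) * w) (- s) =
    (1 - (t%:C * a^*) * w) * rpow (1 - (t%:C * a^*) * w) (- s - 1).
    by rewrite -{2}[1 - _]rpow1// -rpowD; congr rpow; ring.
  by rewrite /dg /C e1 e2 rmorphN; ring.
have [_ [M bM]] := aK.
pose L (r : R) := expR (`|r| * (`|ln (1 - r0)| + `|ln 2|)).
pose K := normc (s%:C * a^*) * L (s - 1) * (2 * (L (- s - 1) * M)).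
have bdg (t : R) w : `|t| < rho -> disc w -> normc (dg t w) <= K.
  move=> tr dw; have L0 r : 0 <= L r by exact: expR_ge0.
  have b1 := normc_rpow_1sub_le (s - 1) r01 (nb _ tr) dxi.
  have b2 := normc_rpow_1sub_le (- s - 1) r01 (nb _ tr) dw.
  have b3 : normc (w - xi) <= 2.
    by rewrite (le_trans (normcD _ _))// normcN -[2]/(1 + 1) lerD// ltW.
  move: b1 b2 (bM _ dw); rewrite /dg /C /K -/(L _) -/(L _).
  move: (rpow _ (s - 1)) (rpow _ (- s - 1)) (kernel xi w)^* => X Y Z bX bY bZ.
  rewrite !normcM.
  by do ![apply: ler_pM; rewrite ?mulr_ge0 ?normc_ge0//].
have dg0 (t : R) : `|t| < rho -> cintegral gamma (dg t) = 0.
  move=> tr; rewrite cintegralZl//; last first.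
    apply: cadmissibleM; last apply: cadmissibleM => //.
      by apply: cadmissibleD; [exact: cadmissible_id|exact: cadmissible_cst].
    by apply: cadmissible_rpow; exact: nb1.
  by rewrite kernel_orthogonal// ?mulr0//; exact: nb1.
have := cintegral_parameter_cst rho1 ag dgE bdg dg0.
have -> : cintegral gamma (g 0) = cintegral gamma (fun w => (kernel xi w)^*).
  apply: eq_cintegral => w _; rewrite /g.
  by rewrite !mul0r subr0 !rpow1n !mul1r.
move=> <-; rewrite -cintegralZl//; last by apply: cadmissibleM => //;
  exact: cadmissible_kernel.
by apply: eq_cintegral => w _; rewrite /g mul1r mulrA.
Qed.

Lemma kernel_reproducing a xi : disc a -> disc xi ->
  cintegral gamma (fun w => kernel a w * (kernel xi w)^*) = kernel a xi.
Proof.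
move=> da dxi; have d0 := @disc0 R.
(* The shift identity at the point 0, where the kernel is the constant 1. Conjugated, it evaluates
   the integral that the shift identity at [xi] leaves. *)
have one x : disc x -> cintegral gamma (kernel x) = 1.
  move=> dx; have k0 w : kernel 0 w = 1 by rewrite /kernel rmorph0 mul0r subr0
    rpow1n.
  have := cintegral_kernel_shift dx d0.
  rewrite mulr0 subr0 rpow1n mul1r.
  under [X in X = _]eq_cintegral do rewrite k0 rmorph1 mulr1.
  under [X in _ = X]eq_cintegral do rewrite k0 rmorph1.
  by rewrite cintegral1.
have := cintegral_kernel_shift da dxi.
rewrite cintegralJ//; last exact: cadmissible_kernel.
rewrite one// rmorph1 => h; rewrite /kernel rpowN.
by apply: (mulfI (rpow_neq0 (1 - a^* * xi) s)); rewrite h mulfV ?rpow_neq0.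
Qed.

End Reproducing.

(** * Complex differentiability of the kernels *)

Section Holomorphy.
Context {R : realType}.
Implicit Types (f : R[i] -> R[i]) (z w b c d h : R[i]).

Lemma normc_le_ReIm z : normc z <= `|Re z| + `|Im z|.
Proof.
rewrite -(@ler_pXn2r _ 2) ?nnegrE ?normc_ge0 ?addr_ge0//.
rewrite normc_sqr sqrrD !real_normK ?num_real// addrAC lerDl.
by rewrite mulrn_wge0// mulr_ge0.
Qed.

(** The real and imaginary parts reach their mean values at different points, hence the factor 2. *)
Lemma mean_value_normc (g dg : R -> R[i]) (M : R) :
  (forall t : R, 0 <= t <= 1 -> is_cderive g t (dg t)) ->
  (forall t : R, 0 <= t <= 1 -> normc (dg t) <= M) ->
  normc (g 1 - g 0) <= 2 * M.
Proof.
move=> dgE bg.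
have [t t01 eR] : exists2 t, t \in `]0, 1[%R & Re (g 1) - Re (g 0) =
  Re (dg t) * (1 - 0).
  apply: (@MVT _ (fun u => Re (g u)) (fun u => Re (dg u)) 0 1 ltr01).
    by move=> t; rewrite in_itv/= => /andP[t0 t1]; case: (dgE t _); rewrite // !ltW.
  apply: continuous_in_subspaceT => t; rewrite inE/= in_itv/= => t01.
  by case: (is_cderive_continuous (dgE t t01)).
have [u u01 eI] : exists2 t, t \in `]0, 1[%R & Im (g 1) - Im (g 0) =
  Im (dg t) * (1 - 0).
  apply: (@MVT _ (fun u => Im (g u)) (fun u => Im (dg u)) 0 1 ltr01).
    by move=> t'; rewrite in_itv/= => /andP[t0 t1]; case: (dgE t' _);
      rewrite // !ltW.
  apply: continuous_in_subspaceT => t'; rewrite inE/= in_itv/= => t01'.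
  by case: (is_cderive_continuous (dgE t' t01')).
have bd v : v \in `]0, 1[%R -> normc (dg v) <= M.
  by rewrite in_itv/= => /andP[v0 v1]; apply: bg; rewrite !ltW.
apply: (le_trans (normc_le_ReIm _)); rewrite !reimE eR eI !subr0 !mulr1.
rewrite mulr_natl mulr2n; apply: lerD.
  exact: le_trans (abs_Re_le _) (bd _ t01).
exact: le_trans (abs_Im_le _) (bd _ u01).
Qed.

Lemma derivable_quadratic f z d (K e : R) : 0 < e ->
  (forall h, normc h < e -> normc (f (z + h) - f z - d * h) <= K * normc h ^+ 2) ->
  derivable (f : R[i]^o -> R[i]^o) z 1.
Proof.
move=> e0 fK; apply/cvg_ex; exists (d : R[i]^o).
apply/cvgrPdist_le => eps eps0.
(* The tolerance is a priori a complex number; being positive, it is real. *)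
have [r re r0] : exists2 r : R, eps = r%:C & 0 < r.
  move: eps0; rewrite ltcE /= => /andP[/eqP i0 r0]; exists (Re eps) => //.
  by apply: complexP; rewrite //= ?i0 -?i0.
have K1 : 0 < `|K| + 1 by rewrite ltr_wpDl.
near=> h.
have h0 : h != 0 by near: h; exact: nbhs_dnbhs_neq.
have nh0 : 0 < normc h.
  rewrite lt_def normc_ge0 andbT; apply: contra h0 =>
    /eqP/ComplexField.Normc.eq0_normc.
  by move=> ->.
have nhe : normc h < Num.min e (r / (`|K| + 1)).
  near: h; set m := Num.min _ _.
  have m0 : 0 < m%:C by rewrite ltcR lt_min e0 divr_gt0.
  apply: filterS (@dnbhs0_lt _ R[i]^o _ m0) => h.
  by rewrite -[`|h|]/((normc h)%:C) ltcR.
move: nhe; rewrite lt_min => /andP[he hr].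
have -> : d - h^-1 *: (f (h *: 1 + z) - f z) = - (h^-1 * (f (z + h) - f z - d * h)).
  rewrite /GRing.scale /= mulr1 [h + z]addrC; field; exact: h0.
rewrite normrN normrM re.
rewrite -[`|h^-1|]/((normc h^-1)%:C) -[X in _ * X <=
  _]/((normc _)%:C) -rmorphM lecR.
rewrite ComplexField.Normc.normcV mulrC ler_pdivrMr//.
apply: le_trans (fK _ he) _.
rewrite expr2 mulrA ler_wpM2r ?normc_ge0//.
move: hr; rewrite ltr_pdivlMr// => /ltW; apply: le_trans.
rewrite mulrC ler_wpM2l ?normc_ge0// (le_trans (ler_norm _))// lerDl.
Unshelve. all: by end_near. Qed.

Lemma is_cderive_segment z h (t : R) : is_cderive (fun u : R => z + u%:C * h) t h.
Proof.
apply: (is_cderive_eq (is_cderiveD (is_cderive_cst z t)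
  (is_cderiveM (is_cderive_id t) (is_cderive_cst h t)))).
by ring.
Qed.

(** Two uses of the mean value inequality on segments: a bounded second derivative makes the first
    one Lipschitz, which makes the first-order remainder quadratic. Increments shorter than 1 - |z|
    stay in the disc, so the extension by 0 is not seen. *)
Lemma derivable_ext0_rpow b c (r : R) z : normc b < 1 -> disc z ->
  derivable (ext0 (fun w => c * rpow (1 - b * w) r) : R[i]^o -> R[i]^o) z 1.
Proof.
move=> b1 dz.
(* The formal [k]-th derivative of c (1 - b w)^r; only k = 0, 1, 2 are used. *)
pose f k w := c * (\prod_(i < k) (- b * (r - i%:R)%:C)) * rpow (1 - b * w) (r -
  k%:R).
have df k (w h : R[i]) (t : R) : disc (w + t%:C * h) ->
    is_cderive (fun u : R => f k (w + u%:C * h)) t (f k.+1 (w + t%:C * h) * h).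
  move=> dw; have lin : is_cderive (fun u : R =>
    1 - b * (w + u%:C * h)) t (- (b * h)).
    apply: (is_cderive_eq (is_cderiveD (is_cderive_cst 1 t) (is_cderiveN
      (is_cderiveM (is_cderive_cst b t) (is_cderive_segment w h t))))).
    by ring.
  apply: (is_cderive_eq (is_cderiveM (is_cderive_cst (c * (\prod_(i < k) (- b *
    (r - i%:R)%:C))) t)
    (is_cderive_rpow (r - k%:R) (Re_1sub_gt0 b1 (ltW dw)) lin))).
  by rewrite /f big_ord_recr /= -natr1 opprD addrA; ring.
have [_ [M bM]] : cadmissible (f 2%N).
  by apply: cadmissibleM; [exact: cadmissible_cst|exact: cadmissible_rpow].
have e0 : 0 < 1 - normc z by rewrite subr_gt0.
have seg h (t : R) : normc h < 1 - normc z -> 0 <= t <= 1 -> disc (z + t%:C * h).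
  move=> hz /andP[t0 t1]; apply: le_lt_trans (normcD _ _) _.
  rewrite normcM normc_real ger0_norm// -ltrBrDl (le_lt_trans _ hz)//.
  by rewrite ler_piMl ?normc_ge0.
have d1 h : normc h < 1 - normc z -> normc (f 1%N (z + h) - f 1%N z) <=
  2 * (M * normc h).
  move=> hz.
  have := @mean_value_normc (fun u => f 1%N (z + u%:C * h)) (fun u =>
    f 2%N (z + u%:C * h) * h) (M * normc h).
  rewrite mul1r mul0r addr0; apply => t t01; first exact: df (seg _ _ hz t01).
  by rewrite normcM ler_wpM2r ?normc_ge0// bM//; exact: seg.
apply: (@derivable_quadratic _ z (f 1%N z) (2 * (2 * M)) (1 - normc z)) => // h hz.
have dzh : disc (z + h) by have := seg h 1 hz; rewrite mul1r; apply;
  rewrite ler01 lexx.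
have f0 w : c * rpow (1 - b * w) r = f 0%N w by rewrite /f big_ord0 mulr1 subr0.
rewrite /ext0 (dz : normc z < 1) (dzh : normc (z + h) < 1) !f0.
pose g (u : R) := f 0%N (z + u%:C * h) - f 0%N z - f 1%N z * (u%:C * h).
have := @mean_value_normc g (fun u => (f 1%N (z + u%:C * h) - f 1%N z) * h) (2
  * M * normc h ^+ 2).
rewrite /g mul1r mul0r addr0 mulr0 subr0 subrr subr0 -!mulrA; apply => t t01.
  apply: (is_cderive_eq (is_cderiveD (is_cderiveD (df 0%N z h t (seg _ _ hz
    t01)) (is_cderive_cst _ t))
     (is_cderiveN (is_cderiveM (is_cderive_cst (f 1%N z) t) (is_cderiveM
       (is_cderive_id t) (is_cderive_cst h t)))))).
  by ring.
have th : normc (t%:C * h) <= normc h.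
  by case/andP: t01 => t0 t1; rewrite normcM normc_real ger0_norm// ler_piMl
    ?normc_ge0.
rewrite normcM expr2 !mulrA ler_wpM2r ?normc_ge0//.
apply: le_trans (d1 _ (le_lt_trans th hz)) _.
rewrite mulrA ler_wpM2l//.
by rewrite mulr_ge0// (le_trans (normc_ge0 (f 2%N z)))// bM.
Qed.

End Holomorphy.

(** * The Berezin transform of the Weyl operator *)

Section BerezinNumber.
Context {R : realType} (gamma : R).
Hypothesis gamma_gtN1 : -1 < gamma.
Notation lebesgue2 := (@lebesgue2 R).
Implicit Types (f : R[i] -> R[i]) (z w a c beta xi : R[i]).

Let s := gamma + 2.

(** Rules out the default value 0 of [to_bergman]: a multiple of a kernel is holomorphic and bounded
    on the disc, hence in the Bergman space. It serves for the normalized kernel and for its image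
    under the operator. *)
Lemma to_bergman_kernel f c a : disc a ->
  (forall w, disc w -> f w = c * kernel gamma a w) ->
  forall w, disc w -> val (to_bergman gamma f) w = c * kernel gamma a w.
Proof.
move=> da fE; pose F w := c * kernel gamma a w.
have aF : cadmissible F.
  by apply: cadmissibleM; [exact: cadmissible_cst|exact: cadmissible_kernel].
have fF : ext0 f = ext0 F.
  by apply/funext => w; rewrite /ext0; case: ifPn => // /fE.
have mem : ext0 f \in bergman_set gamma.
  rewrite inE fF; split.
  - by move=> z dz; apply: derivable_ext0_rpow => //; rewrite normcJ.
  - have [mF [M bM]] := aF.
    have F0 p : 0 <= normc (F (cplx p)) ^+ 2 * dens gamma (cplx p).
      exact: mulr_ge0 (sqr_ge0 _) (dens_ge0 gamma_gtN1 _).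
    have /integrableP[_ Ffin] : lebesgue2.-integrable (@pdisc R)
        (EFin \o (fun p => normc (F (cplx p)) ^+ 2 * dens gamma (cplx p))).
      apply: (@integrable_le_dens _ gamma gamma_gtN1 _ (M ^+ 2)).
        apply: measurable_funM; last exact: measurable_dens.
        by apply: measurable_funX; exact: measurable_normc.
      move=> p dp; rewrite ger0_norm//; rewrite ler_wpM2r ?(dens_ge0
        gamma_gtN1)// lerXn2r ?nnegrE ?normc_ge0 ?bM//.
      exact: le_trans (normc_ge0 _) (bM _ dp).
    apply: le_lt_trans Ffin.
    rewrite /sqnorm le_eqVlt; apply/orP; left; apply/eqP/eq_integral => p;
      rewrite inE => dp.
    by rewrite /ext0 (dp : normc (cplx p) < 1) [in RHS]/= ger0_norm.
  - by apply/funext => w; rewrite {1}/ext0; case: ifPn => // h;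
    rewrite /ext0 (negbTE h).
move=> w dw; rewrite /to_bergman insubdK//.
by rewrite fF /ext0 (dw : normc w < 1).
Qed.

Lemma nkernel_funE xi w : disc xi -> disc w ->
  nkernel_fun gamma xi w = ((1 - normc xi ^+ 2) `^ (s / 2))%:C * kernel gamma xi w.
Proof.
move=> dxi dw; rewrite /nkernel_fun cpow_rpow.
  by rewrite /kernel rpowN.
by apply: Re_1sub_gt0; rewrite ?normcJ// ltW.
Qed.

Lemma normc_lt_sqr z w : normc z ^+ 2 < normc w ^+ 2 -> normc z < normc w.
Proof. by rewrite ltr_pXn2r ?nnegrE ?normc_ge0. Qed.

Lemma denom_neq0 beta w : disc beta -> disc w -> 1 - beta^* * w != 0.
Proof.
move=> db dw; have : 0 < Re (1 - beta^* * w).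
  by apply: Re_1sub_gt0; rewrite ?normcJ// ltW.
by apply: contraTneq => ->; rewrite ltxx.
Qed.

Lemma mobius_disc beta w : disc beta -> disc w -> disc (mobius beta 1 w).
Proof.
move=> db dw; have n0 := denom_neq0 db dw.
rewrite /disc /= -/(normc _) /mobius mul1r.
change (normc ((w - beta) / (1 - beta^* * w)) < 1).
rewrite normcM ComplexField.Normc.normcV ltr_pdivrMr; last first.
  by rewrite lt_def normc_ge0 andbT; apply: contra n0 =>
    /eqP/ComplexField.Normc.eq0_normc ->.
rewrite mul1r; apply: normc_lt_sqr; rewrite -subr_gt0 !normc_sqr.
have b1 : 0 < 1 - normc beta ^+ 2 by rewrite subr_gt0 expr_lt1 ?normc_ge0.
have w1 : 0 < 1 - normc w ^+ 2 by rewrite subr_gt0 expr_lt1 ?normc_ge0.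
(* The identity behind this is |1 - conj(beta) w|^2 - |w - beta|^2 = (1 - |beta|^2) (1 - |w|^2). *)
have := mulr_gt0 b1 w1; rewrite !normc_sqr !reimE /=.
by congr (0 < _); ring.
Qed.

Lemma berezin_weyl beta xi : disc beta -> disc xi ->
  normc (berezin (weyl (gamma := gamma) beta 1) xi) =
  (1 - normc beta ^+ 2) `^ (s / 2) * (1 - normc xi ^+ 2) `^ s *
  normc ((1 - normc xi ^+ 2) +i* (2 * Im (xi^* * beta))) `^ (- s).
Proof.
move=> db dxi; pose a := mobius (- beta) 1 xi.
have dNb : disc (- beta) by rewrite /disc /= -/(normc _) normcN.
have da : disc a by exact: mobius_disc.
pose cb := ((1 - normc beta ^+ 2) `^ (s / 2))%:C.
pose cx := ((1 - normc xi ^+ 2) `^ (s / 2))%:C.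
(* The conjugate of the denominator of [a]; multiplying by it clears the fraction in conj(a). *)
pose u := 1 + xi^* * beta.
have u0 : 0 < Re u.
  have -> : u = 1 - xi^* * (- beta) by rewrite /u; ring.
  by apply: Re_1sub_gt0; rewrite ?normcJ ?normcN// ltW.
have un0 : u != 0 by apply: contraTneq u0 => ->; rewrite ltxx.
have aE : a^* * u = beta^* + xi^*.
  rewrite /a /mobius mul1r opprK rmorphM fmorphV /=.
  have -> : (xi + beta)^* = xi^* + beta^* by rewrite rmorphD.
  have -> : (1 - (- beta)^* * xi)^* = u.
    by rewrite rmorphB rmorph1 rmorphM /= conjCK /u; ring.
  by rewrite mulrAC -mulrA mulfV// mulr1 addrC.
have kx := @to_bergman_kernel _ _ _ dxi (fun w => @nkernel_funE xi w dxi).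
have kT : forall w, disc w -> nkernel_fun gamma beta w *
    val (nkernel gamma xi) (mobius beta 1 w) =
      (cb * cx * rpow u (- s)) * kernel gamma a w.
  move=> w dw; have dm := mobius_disc db dw.
  rewrite nkernel_funE// kx//.
  have R1 (x y : R[i]) : disc x -> disc y -> 0 < Re (1 - x^* * y).
    by move=> dx dy; apply: Re_1sub_gt0; rewrite ?normcJ// ltW.
  (* The two products agree: both equal u - (conj(beta) + conj(xi)) w. This is how the operator
     carries one kernel to a multiple of another. *)
  have := @rpowM _ (1 - beta^* * w) (1 - xi^* * mobius beta 1 w) u (1 - a^* *
    w) (- s)
    (R1 _ _ db dw) (R1 _ _ dxi dm) u0 (R1 _ _ da dw).
  rewrite /kernel -/s => h; rewrite -[RHS]mulrA -h; first by rewrite /cb /cx; ring.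
  have -> : u * (1 - a^* * w) = u - (a^* * u) * w by ring.
  rewrite aE /mobius mul1r /u.
  by field; exact: denom_neq0.
have vT := to_bergman_kernel da kT.
rewrite /berezin /inner.
have -> : cintegral gamma (fun z => val (weyl beta 1 (nkernel gamma xi)) z *
  (val (nkernel gamma xi) z)^*)
   = (cb * cx * rpow u (- s)) * cx * kernel gamma a xi.
  rewrite -(kernel_reproducing gamma_gtN1 da dxi) -cintegralZl//; last first.
    by apply: cadmissibleM; [|apply: cadmissibleJ]; exact: cadmissible_kernel.
  apply: eq_cintegral => w dw; rewrite vT// kx// -/cx.
  have cxJ : cx^* = cx by apply: complexP; rewrite !reimE /= ?oppr0.
  have -> : (cx * kernel gamma xi w)^* = cx * (kernel gamma xi w)^*.
    by rewrite rmorphM /= -/cx cxJ.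
  by ring.
have x1 : 0 < 1 - normc xi ^+ 2 by rewrite subr_gt0 expr_lt1 ?normc_ge0.
(* Expanding leaves 1 - |xi|^2 plus conj(xi) beta minus its conjugate, which is purely imaginary. *)
have e : u * (1 - a^* * xi) = ((1 - normc xi ^+ 2) +i* (2 * Im (xi^* * beta))).
  have -> : u * (1 - a^* * xi) = u - (a^* * u) * xi by ring.
  rewrite aE /u normc_sqr.
  by apply: complexP; rewrite !reimE /=; ring.
have k0 : 0 < Re (1 - a^* * xi) by apply: Re_1sub_gt0; rewrite ?normcJ// ltW.
rewrite -e [normc (u * _)]normcM powRM ?normc_ge0// -(normc_rpow _ u0)
  -(normc_rpow _ k0).
rewrite /kernel -/s; move: (rpow u (- s)) (rpow (1 - a^* * xi) (- s)) => X Y.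
rewrite !normcM /cb /cx !normc_real !ger0_norm ?powR_ge0//.
have -> : (1 - normc xi ^+ 2) `^ s = (1 - normc xi ^+ 2) `^ (s / 2) * (1 -
  normc xi ^+ 2) `^ (s / 2).
  by rewrite -powRD ?(gt_eqF x1) ?implybT//; congr powR; field.
by ring.
Qed.

Lemma ber_weyl beta : disc beta ->
  ber (weyl (gamma := gamma) beta 1) = ((1 - normc beta ^+ 2) `^ (s / 2))%:E.
Proof.
move=> db; have s0 : 0 < s.
  by rewrite /s -[2]/(1 + 1) addrA addr_gt0// -ltrBlDr sub0r.
apply/eqP; rewrite eq_le; apply/andP; split.
  apply: ge_ereal_sup => _ [xi dxi <-]; rewrite lee_fin berezin_weyl//.
  have x1 : 0 < 1 - normc xi ^+ 2 by rewrite subr_gt0 expr_lt1 ?normc_ge0.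
  rewrite -mulrA ler_piMr ?powR_ge0// powRN.
  set m := normc (_ +i* _).
  have xm : 1 - normc xi ^+ 2 <= m.
    exact: le_trans (ler_norm _) (abs_Re_le ((1 - normc xi ^+ 2) +i* (2 * Im
      (xi^* * beta)))).
  have m0 : 0 < m by exact: lt_le_trans xm.
  rewrite ler_pdivrMr ?powR_gt0// mul1r.
  by rewrite ge0_ler_powR// ?nnegrE// ltW.
apply: ereal_sup_ubound; exists 0; first exact: disc0.
rewrite berezin_weyl//; last exact: disc0.
rewrite ComplexField.Normc.normc0 expr0n subr0 rmorph0 mul0r mulr0.
by rewrite (@normc_real _ 1) normr1 !powR1 !mulr1.
Qed.

End BerezinNumber.

Theorem theorem3p4 (R : realType) (gamma : R) (beta : R[i])
    (hgamma : -1 < gamma) (hbeta : disc beta) :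
  ber (weyl (gamma := gamma) beta 1)
  = ((1 - normc beta ^+ 2) `^ ((gamma + 2) / 2))%:E.
Proof.
exact: ber_weyl.
Qed.
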